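(* Let $\mathcal{O}=\{Q^T X_0 Q \mid Q\in \mathrm{SO}(n)\}$ be the orthogonal conjugacy class of a traceless real symmetric $n\times n$ matrix $X_0$. Then for each diagonal matrix $\Lambda=\mathrm{diag}(\lambda_1,\dots,\lambda_n)\in\mathcal{O}$ there exist an open neighborhood $\mathcal{V}_\Lambda\subset\mathcal{O}$ of $\Lambda$ and a diffeomorphism (local coordinates) $\varphi_\Lambda:\mathcal{V}_\Lambda\to \mathrm{L}^\Lambda$ onto the affine space $\mathrm{L}^\Lambda$ that transforms (pushes forward) the restriction to $\mathcal{V}_\Lambda$ of the Toda vector field $X'=[X,\pi_{\mathfrak{so}}X]$ on $\mathcal{O}$ into the diagonal linear vector field $$L'=[L,-\Lambda],\qquad L\in \mathrm{L}^\Lambda,$$ that is, $L'_{ij}=(\lambda_i-\lambda_j)L_{ij}$ for all $i,j$. Moreover, each domain $\mathcal{V}_\Lambda$ is dense in $\mathcal{O}$, and the union of the domains $\mathcal{V}_\Lambda$ over the (finitely many) diagonal matrices $\Lambda\in\mathcal{O}$ is all of $\mathcal{O}$.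
   Context: All matrices are real of size $n\times n$. $\mathrm{SO}(n)$ is the special orthogonal group; $\mathfrak{sl}$ is the space of traceless matrices, $\mathfrak{so}$ the subspace of skew-symmetric matrices, $\mathfrak{u}$ the subspace of traceless upper triangular matrices. One has $\mathfrak{sl}=\mathfrak{so}\oplus\mathfrak{u}$, and $\pi_{\mathfrak{so}}:\mathfrak{sl}\to\mathfrak{so}$ denotes the projection along $\mathfrak{u}$. The bracket is $[A,B]=AB-BA$. The Toda vector field on $\mathfrak{sl}$ is $X'=[X,\pi_{\mathfrak{so}}X]$; it is tangent to every orthogonal conjugacy class $\mathcal{O}$ of traceless symmetric matrices (the eigenvalues may have arbitrary multiplicities). The class $\mathcal{O}$ is regarded as an embedded submanifold of the space of symmetric matrices. Let $\mathrm{L}$ be the group of unit lower triangular matrices (lower triangular with all diagonal entries equal to $1$). For a diagonal matrix $\Lambda$ with diagonal entries $\lambda_1,\dots,\lambda_n$, define the affine space $$\mathrm{L}^\Lambda=\{L\in\mathrm{L}\mid L_{ij}=0 \text{ whenever } \lambda_i=\lambda_j \text{ and } i\neq j\}.$$ Linear coordinates on $\mathrm{L}^\Lambda$ are the free strictly lower triangular entries, with the identity matrix as origin; the vector field $L'=[L,-\Lambda]$ is tangent to $\mathrm{L}^\Lambda$. *)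

(* Defs.v *)
From HB Require Import structures.
From mathcomp Require Import all_boot all_order all_algebra.
From mathcomp Require Import all_classical all_reals all_analysis.
Set Implicit Arguments.
Unset Strict Implicit.
Unset Printing Implicit Defensive.
Import Order.TTheory GRing.Theory Num.Theory.
Import numFieldNormedType.Exports.
Local Open Scope classical_set_scope.
Local Open Scope ring_scope.

Section Smooth.
Variable R : realType.

(* [f] is of class C^k on the open set [U]; [V] and [W] are meant to be
   finite-dimensional, so that asking each [x |-> 'd f x v] to be C^k amounts
   to asking [x |-> 'd f x] to be C^k. *)
Fixpoint Ck (k : nat) (V W : normedModType R) (U : set V) (f : V -> W) : Prop :=
  match k with
  | 0 => forall x, U x -> {for x, continuous f}
  | k'.+1 => (forall x, U x -> differentiable f x) /\
             (forall v : V, Ck k' U (fun x => 'd f x v))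
  end.

Definition smooth_extension (V W : normedModType R) (S : set V) (f : V -> W)
    (x : V) (U : set V) (F : V -> W) : Prop :=
  [/\ open U, U x, forall k, Ck k U F & forall y, U y -> S y -> F y = f y].

(* Smoothness on an arbitrary subset [S] of a finite-dimensional space: [f]
   extends locally to smooth maps on open sets. When [S] is an embedded
   submanifold this is smoothness in the sense of manifolds. Only the values
   of [f] on [S] matter. *)
Definition smooth_on (V W : normedModType R) (S : set V) (f : V -> W) : Prop :=
  forall x, S x -> exists U F, smooth_extension S f x U F.

Definition diffeomorphism (V W : normedModType R) (A : set V) (B : set W)
    (f : V -> W) : Prop :=
  [/\ set_bij A B f, smooth_on A f &
      exists2 g : W -> V, (forall x, A x -> g (f x) = x) & smooth_on B g].

(* The differential of [f] at [x \in S] is the restriction of ['d F x] to the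
   tangent space of [S], for any local smooth extension [F] of [f]. Quantifying
   over all extensions makes the condition independent of the choice of [F];
   extensions exist as soon as [smooth_on S f]. *)
Definition pushes_forward (V W : normedModType R) (S : set V) (f : V -> W)
    (X : V -> V) (Y : W -> W) : Prop :=
  forall x, S x ->
  forall U F, smooth_extension S f x U F -> 'd F x (X x) = Y (f x).

End Smooth.

Section Toda.
Variables (R : realType) (n : nat).
Implicit Types (X Q A B L : 'M[R]_n) (lam : 'rV[R]_n).

Definition SO : set 'M[R]_n := [set Q | Q^T *m Q = 1%:M /\ \det Q = 1].

Definition sl_mx : set 'M[R]_n := [set X | \tr X = 0].

Definition so_mx : set 'M[R]_n := [set X | X^T = - X].

Definition u_mx : set 'M[R]_n :=
  [set X | \tr X = 0 /\ forall i j : 'I_n, (j < i)%N -> X i j = 0].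

(* The component in [so_mx] of [X \in sl_mx] in the decomposition
   sl = so (+) u; see [pi_soP] and [pi_so_uniq]. *)
Definition pi_so X : 'M[R]_n := xget 0 [set P | so_mx P /\ u_mx (X - P)].

Lemma pi_soP X : sl_mx X -> so_mx (pi_so X) /\ u_mx (X - pi_so X).
Proof.
move=> trX; rewrite /pi_so; case: xgetP => [P _ //|noP].
pose P := \matrix_(i, j) (if (j < i)%N then X i j
                          else if (i < j)%N then - X j i else 0) : 'M[R]_n.
have trP : \tr P = 0 by rewrite /mxtrace big1 // => i _; rewrite mxE ltnn.
case: (noP P); split; [apply/matrixP => i j | split].
- by rewrite !mxE; case: ltngtP => // _; rewrite ?opprK ?oppr0.
- by rewrite linearB /= trX trP subr0.
- by move=> i j ji; rewrite !mxE ji subrr.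
Qed.

Lemma pi_so_uniq X P : so_mx P -> u_mx (X - P) -> pi_so X = P.
Proof.
move=> soP uP; apply: xget_unique => // Q [soQ uQ].
have lower (i j : 'I_n) : (j < i)%N -> Q i j = P i j.
  move=> ji; move: (uP.2 i j ji) (uQ.2 i j ji); rewrite !mxE => /subr0_eq <-.
  by move=> /subr0_eq.
have skew (M : 'M[R]_n) i j : so_mx M -> M i j = - M j i.
  by move=> /matrixP /(_ j i); rewrite !mxE.
apply/matrixP => i j; case: (ltngtP i j) => [ij|ji|/val_inj ->].
- by rewrite (skew Q) // (skew P) // lower.
- exact: lower.
- have diag0 (M : 'M[R]_n) : so_mx M -> M j j = 0.
    move=> soM; have /eqP := skew M j j soM.
    by rewrite -addr_eq0 -mulr2n mulrn_eq0 => /eqP.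
  by rewrite !diag0.
Qed.

Definition lie_bracket A B : 'M[R]_n := A *m B - B *m A.

Definition toda X : 'M[R]_n := lie_bracket X (pi_so X).

Definition orth_class X0 : set 'M[R]_n := [set Q^T *m X0 *m Q | Q in SO].

Definition unit_lower : set 'M[R]_n :=
  [set L | is_trig_mx L /\ forall i, L i i = 1].

(* The affine space L^Lambda for Lambda = [diag_mx lam]. *)
Definition unit_lower_at lam : set 'M[R]_n :=
  [set L | unit_lower L /\
           forall i j, lam ord0 i = lam ord0 j -> i != j -> L i j = 0].

End Toda.

(* Main.v *)
(* Write X = Q^T Lambda Q.  Lambda fixes the order of the eigenvalues, not the
   frame Q inside the eigenspaces; the frame is chosen so that it factors as
   Q = L U, with L in L^Lambda and U upper triangular with positive diagonal.
   Given L, this is the QR decomposition of L, whence the inverse chart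
   L |-> (LU)^T Lambda (LU).  Given X, let P_i be the projection onto the
   eigenspace of lambda_i, a polynomial in X, and let W = U^-1 have columns w_i.
   Then w_i^T P_i w_j = L_ij, so that w_i^T P_i w_j = delta_ij for i <= j, and
   this system determines W by a Gram-Schmidt process in which the bilinear
   form changes at every step.  The chart is therefore explicit, and its domain
   is the open set where all the pivots of the process are positive.  The QR
   decomposition is the same process for the constant form L^T L.
   - Push-forward: along L' = [L, -Lambda], the derivative of Q is Q S with S
     skew-symmetric and X - S upper triangular, so S is the so-part of X.
   - Covering: when the process is run on X the next pivot is positive for some
     eigenvalue, because the eigenprojections of a nonzero vector do not all
     vanish; choosing such an eigenvalue at each step produces Lambda.
   - Density: up to signs of its rows Q has no eigenvalue -1, hence is joined
     to the identity by a Cayley path, along which the pivots are rational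
     functions of the parameter that do not vanish at the identity. *)
Require Import Defs.
From HB Require Import structures.
From mathcomp Require Import all_boot all_order all_algebra.
From mathcomp Require Import all_classical all_reals all_analysis.
From mathcomp Require Import ring lra.
From mathcomp Require sesquilinear spectral.
From mathcomp.real_closed Require complex.
Import Order.TTheory GRing.Theory Num.Theory.
Import numFieldNormedType.Exports.
Local Open Scope classical_set_scope.
Local Open Scope ring_scope.

Set Implicit Arguments.
Unset Strict Implicit.
Unset Printing Implicit Defensive.

(** * Gram-Schmidt process for a varying bilinear form *)

Section Triangular.
Variables (F : fieldType) (n : nat).
Implicit Types A B : 'M[F]_n.

Definition upper_mx A := forall i j : 'I_n, (j < i)%N -> A i j = 0.

Lemma upper_mxM A B : upper_mx A -> upper_mx B -> upper_mx (A *m B).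
Proof.
move=> uA uB i j ji; rewrite mxE big1// => k _.
by case: (ltnP k i) => [/uA->|ik]; rewrite ?mul0r// uB ?mulr0// (leq_trans ji).
Qed.

Lemma upper_mxM_diag A B i : upper_mx A -> upper_mx B ->
  (A *m B) i i = A i i * B i i.
Proof.
move=> uA uB; rewrite mxE (bigD1 i)//= big1 ?addr0// => k ki.
case: (ltngtP k i) => [/uA->|/uB->|/val_inj/eqP]; rewrite ?mul0r ?mulr0//.
by rewrite (negPf ki).
Qed.

Lemma det_upper A : upper_mx A -> \det A = \prod_i A i i.
Proof.
move=> uA; rewrite -det_tr det_trig.
  by apply: eq_bigr => i _; rewrite mxE.
by apply/is_trig_mxP => i j ij; rewrite mxE uA.
Qed.

Lemma upper_unitmx A : upper_mx A -> (forall i, A i i != 0) -> A \in unitmx.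
Proof.
by move=> uA A0; rewrite unitmxE unitfE det_upper//; apply/prodf_neq0 => i _.
Qed.

Lemma upper_mx_inv A : upper_mx A -> (forall i, A i i != 0) ->
  upper_mx (invmx A).
Proof.
move=> uA A0 i j; elim/ltn_ind: {j}(j : nat) {-2}j (erefl (j : nat)).
move=> m IH j jm.
move=> ji; have /matrixP/(_ i j) := mulVmx (upper_unitmx uA A0).
rewrite !mxE (bigD1 j)//= big1 ?addr0 => [|k kj].
  rewrite -val_eqE/= gtn_eqF// => /eqP.
  by rewrite mulf_eq0 (negPf (A0 j)) orbF => /eqP.
case: (ltngtP k j) => [lkj|/uA->|/val_inj/eqP]; last by rewrite (negPf kj).
  by rewrite (IH k) ?mul0r// -?jm// (ltn_trans lkj).
by rewrite mulr0.
Qed.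

Lemma upper_mx_inv_diag A i : upper_mx A -> (forall i, A i i != 0) ->
  invmx A i i = (A i i)^-1.
Proof.
move=> uA A0; apply: (mulIf (A0 i)).
rewrite -upper_mxM_diag ?mulVmx ?mxE ?eqxx ?mulVf//; first exact: upper_unitmx.
exact: upper_mx_inv.
Qed.

End Triangular.

(** * The unnormalized process: orthogonality and uniqueness *)

Section GramSchmidt.
Variables (R : fieldType) (n : nat).
Implicit Types (A : 'I_n -> 'M[R]_n) (B T V W : 'M[R]_n).

Definition unit_upper W := forall i j : 'I_n, (j <= i)%N -> W i j = (i == j)%:R.

(* The step for the form [B] makes the columns after the [k]-th one
   [B]-orthogonal to it, on the right only since [B] need not be symmetric. *)
Definition gs_step B (k : 'I_n) W : 'M[R]_n :=
  let G := W^T *m B *m W in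
  \matrix_(i, j) (W i j - (if (k < j)%N then G k j / G k k else 0) * W i k).

(** The number of steps is a natural number so that induction is unrestricted; [insub] turns it into
    an index, and steps beyond the size of the matrix do nothing. *)
Fixpoint gs A (m : nat) : 'M[R]_n :=
  if m is m'.+1 then
    if insub m' is Some k then gs_step (A k) k (gs A m') else gs A m'
  else 1%:M.

(** Taken just before step [k], when column [k] is already final; this is the number by which that
    step divides. *)
Definition gs_pivot A (k : 'I_n) : R := ((gs A k)^T *m A k *m gs A k) k k.

Lemma congr_entryE B W i j :
  (W^T *m B *m W) i j = ((col i W)^T *m B *m col j W) 0 0.
Proof.
rewrite tr_col -row_mul -row_mul !mxE.
by apply: eq_bigr => k _; rewrite !mxE.
Qed.

Lemma gsS A (k : 'I_n) : gs A k.+1 = gs_step (A k) k (gs A k).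
Proof. by rewrite /= valK. Qed.

Lemma col_gs_step B k W j : col j (gs_step B k W) =
  col j W - (if (k < j)%N then (W^T *m B *m W) k j / (W^T *m B *m W) k k else 0)
            *: col k W.
Proof. by apply/matrixP => i l; rewrite !mxE. Qed.

Lemma unit_upper1 : unit_upper 1%:M.
Proof. by move=> i j _; rewrite mxE. Qed.

Lemma unit_upper_gs A m : unit_upper (gs A m).
Proof.
elim: m => [|m IHm]; first exact: unit_upper1.
rewrite /=; case: insubP => // k _ _ i j ji; rewrite mxE IHm//.
case: ifP => [kj|_]; last by rewrite mul0r subr0.
have ki : (k < i)%N by exact: leq_trans ji.
have -> : gs A m i k = 0 by rewrite IHm ?(ltnW ki)// -val_eqE/= gtn_eqF.
by rewrite mulr0 subr0.
Qed.

(** Step [k] changes only the columns after [k], so column [j] is final once [j] steps are done. *)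
Lemma gs_stable A m m' (j : 'I_n) :
  (j <= m <= m')%N -> col j (gs A m') = col j (gs A m).
Proof.
move=> /andP[jm]; elim: m' => [|m' IH]; first by rewrite leqn0 => /eqP->.
rewrite leq_eqVlt => /predU1P[->//|]; rewrite ltnS => mm'.
rewrite -IH//=; case: insubP => // k _ /= km.
by rewrite col_gs_step km ltnNge (leq_trans jm mm')/= scale0r subr0.
Qed.

Lemma eq_gs A A' m : (forall k : 'I_n, (k < m)%N -> A k = A' k) ->
  gs A m = gs A' m.
Proof.
elim: m => // m IHm AA'; rewrite /= IHm => [|k km]; last exact/AA'/ltnW.
by case: insubP => // k _ km; rewrite AA'// km.
Qed.

(** A pivot does not see the later forms; this allows the forms to be chosen one after the other. *)
Lemma eq_gs_pivot A A' (m : 'I_n) :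
  (forall k : 'I_n, (k <= m)%N -> A k = A' k) ->
  gs_pivot A m = gs_pivot A' m.
Proof.
move=> AA'; rewrite /gs_pivot AA'// (@eq_gs A A')// => k /ltnW; exact: AA'.
Qed.

(** Step [l] subtracts from later columns a multiple of column [l], which for [k < l] is itself
    orthogonal to column [k], so earlier relations survive. The relation for [k = l] is produced by
    the coefficient of the step, its pivot being nonzero. *)
Lemma gs_orth A m : (m <= n)%N ->
    (forall k : 'I_n, (k < m)%N -> gs_pivot A k != 0) ->
  forall k j : 'I_n, (k < m)%N -> (k < j)%N ->
    ((gs A m)^T *m A k *m gs A m) k j = 0.
Proof.
elim: m => // m IHm mn piv k j; rewrite ltnS => km kj.
have := IHm (ltnW mn) (fun k km => piv k (ltnW km)) k.
have -> : m = Ordinal mn by [].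
set l := Ordinal mn => {}IHm; rewrite congr_entryE.
rewrite [col k _](@gs_stable _ l)// ?leqnSn ?andbT//.
have mulBZ (u : 'rV[R]_n) (v w : 'cV[R]_n) c :
    (u *m (v - c *: w)) 0 0 = (u *m v) 0 0 - c * (u *m w) 0 0.
  by rewrite mulmxBr -scalemxAr !mxE.
rewrite gsS col_gs_step mulBZ -!congr_entryE.
move: km; rewrite leq_eqVlt => /predU1P[kl|km]; last first.
  by rewrite IHm// IHm// mulr0 subr0.
have {}kl : k = l by exact: val_inj.
by rewrite -kl kj divfK ?subrr// kl; exact: (piv l).
Qed.

Lemma pivotE A m (k : 'I_n) : (k <= m)%N ->
  ((gs A m)^T *m A k *m gs A m) k k = gs_pivot A k.
Proof.
by move=> km; rewrite congr_entryE (@gs_stable _ k) ?leqnn// -congr_entryE.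
Qed.

Lemma unit_upper_sum T (u : 'I_n -> R) (k j : 'I_n) :
    unit_upper T -> (forall i l : 'I_n, (i < k)%N -> T i l = (i == l)%:R) ->
    (forall i : 'I_n, (k < i)%N -> u i = 0) -> (k <= j)%N ->
  \sum_i u i * T i j = u k * T k j.
Proof.
move=> Tu Tk uk kj; rewrite (bigD1 k)//= big1 ?addr0// => i ik.
case: (ltngtP i k) => [lik|lki|/val_inj/eqP]; last by rewrite (negPf ik).
  by rewrite Tk// -val_eqE/= ltn_eqF ?mulr0//; exact: leq_trans kj.
by rewrite uk ?mul0r.
Qed.

Lemma unit_upperP W : unit_upper W <-> upper_mx W /\ forall i, W i i = 1.
Proof.
split=> [uW|[uW W1] i j]; first split=> [i j ji|i].
- by rewrite uW ?(ltnW ji)// -val_eqE/= gtn_eqF.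
- by rewrite uW ?eqxx.
rewrite leq_eqVlt => /predU1P[/val_inj->|ji]; first by rewrite eqxx.
by rewrite uW// -val_eqE/= gtn_eqF.
Qed.

Lemma unit_upper_inv W : unit_upper W -> unit_upper (invmx W).
Proof.
move=> /unit_upperP[uW W1].
have W0 i : W i i != 0 by rewrite W1 oner_neq0.
apply/unit_upperP; split=> [|i]; first exact: upper_mx_inv.
by rewrite upper_mx_inv_diag// W1 invr1.
Qed.

Lemma unit_upper_unit W : unit_upper W -> W \in unitmx.
Proof.
move=> /unit_upperP[uW W1].
by apply: upper_unitmx => // i; rewrite W1 oner_neq0.
Qed.

Section Uniqueness.
Variables (A : 'I_n -> 'M[R]_n) (W : 'M[R]_n).
Hypothesis Wu : unit_upper W.
Hypothesis W0 : forall k j : 'I_n, (k < j)%N -> (W^T *m A k *m W) k j = 0.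
Hypothesis Wd : forall k : 'I_n, (W^T *m A k *m W) k k != 0.

(* The shape of [T] says that the first [m] columns of [W] have been found and
   no longer occur in the other columns. *)
Lemma gs_factor m : (m <= n)%N -> exists T, [/\ gs A m = W *m T, unit_upper T &
    forall k j : 'I_n, (k < m)%N -> T k j = (k == j)%:R].
Proof.
elim: m => [_|m IHm mn].
  exists (invmx W); split=> //; last exact: unit_upper_inv.
  by rewrite mulmxV// unit_upper_unit.
have [T [gsT uT Tm]] := IHm (ltnW mn).
pose l := Ordinal mn; pose c (j : 'I_n) := if (l < j)%N then T l j else 0.
(* Rows before [l] of [T] are those of the identity, and [T] is unit upper triangular: hence column
   [l] of [W *m T] is already that of [W]. *)
have colT : col l T = delta_mx l 0.
  apply/matrixP => i j; rewrite !mxE ord1 eqxx andbT.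
  case: (ltnP i m) => [im|mi]; first by rewrite Tm.
  by rewrite uT.
have G (j : 'I_n) : (l <= j)%N -> ((W *m T)^T *m A l *m (W *m T)) l j =
    (W^T *m A l *m W) l l * T l j.
  move=> lj.
  have -> : (W *m T)^T *m A l *m (W *m T) = T^T *m (W^T *m A l *m W *m T).
    by rewrite trmx_mul !mulmxA.
  rewrite mxE (bigD1 l)//= big1 ?addr0 => [|i il]; last first.
    by move/matrixP/(_ i 0): colT; rewrite !mxE (negPf il) => ->; rewrite mul0r.
  rewrite mxE uT ?leqnn// eqxx mul1r mxE.
  apply: (@unit_upper_sum _ (fun i => (W^T *m A l *m W) l i)) => // i li.
  exact: W0.
exists (\matrix_(i, j) (T i j - c j * T i l)); split.
- have -> : m.+1 = l.+1 by [].
  rewrite gsS [gs A l]gsT; apply/matrixP => i j.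
  rewrite mxE [in RHS]mxE [(W *m T) i j]mxE [(W *m T) i l]mxE.
  under [RHS]eq_bigr do rewrite mxE mulrBr.
  rewrite sumrB; congr (_ - _).
  under [RHS]eq_bigr do rewrite mulrCA.
  rewrite -[RHS]mulr_sumr; congr (_ * _); rewrite /c; case: ifP => // lj.
  by rewrite !G ?(ltnW lj)// (uT l l)// eqxx mulr1 mulrC mulKf//; exact: (Wd l).
- move=> i j ji; rewrite mxE uT// /c.
  case: ifP => [lj|_]; last by rewrite mul0r subr0.
  have -> : T i l = 0.
    rewrite uT ?(leq_trans (ltnW lj))// -val_eqE gtn_eqF//.
    exact: leq_trans ji.
  by rewrite mulr0 subr0.
- move=> k j; rewrite ltnS leq_eqVlt => /predU1P[kl|km].
    have {kl}-> : k = l by exact: val_inj.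
    rewrite mxE [T l l]uT// eqxx mulr1 /c; case: (ltnP l j) => [lj|jl].
      by rewrite subrr -val_eqE/= ltn_eqF.
    by rewrite subr0 uT.
  by rewrite mxE !Tm// -[k == l]val_eqE/= (ltn_eqF km) mulr0 subr0.
Qed.

Lemma gs_uniq : gs A n = W.
Proof.
have [T [-> _ T1]] := gs_factor (leqnn n).
by rewrite (_ : T = 1%:M) ?mulmx1//; apply/matrixP => i j; rewrite T1 ?mxE.
Qed.

Lemma gs_pivot_uniq k : gs_pivot A k = (W^T *m A k *m W) k k.
Proof. by rewrite -(@pivotE _ n) ?gs_uniq// ltnW. Qed.

End Uniqueness.

End GramSchmidt.

(** * Normalized columns and uniqueness of the triangular frame *)

Section Normalization.
Variables (R : rcfType) (n : nat).
Implicit Types (A : 'I_n -> 'M[R]_n) (W : 'M[R]_n).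

Definition gs_pos A := forall k, 0 < gs_pivot A k.

Definition gs_normal A : 'M[R]_n :=
  \matrix_(i, j) (gs A n i j / Num.sqrt (gs_pivot A j)).

(** Only the entries with [k <= j] are prescribed; those below the diagonal stay free and become the
    coordinates of the chart. *)
Definition triangular_frame A W := [/\ upper_mx W, forall i, 0 < W i i &
  forall k j : 'I_n, (k <= j)%N -> (W^T *m A k *m W) k j = (k == j)%:R].

Lemma congr_diag_entry A W (d : 'rV[R]_n) k i j :
  ((W *m diag_mx d)^T *m A k *m (W *m diag_mx d)) i j =
  d 0 i * d 0 j * (W^T *m A k *m W) i j.
Proof.
rewrite trmx_mul tr_diag_mx -!mulmxA mul_diag_mx mxE !mulmxA mul_mx_diag mxE.
by rewrite -mulrA (mulrC (d 0 j)).
Qed.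

Lemma gs_normalE A :
  gs_normal A = gs A n *m diag_mx (\row_j (Num.sqrt (gs_pivot A j))^-1).
Proof. by apply/matrixP => i j; rewrite mul_mx_diag !mxE. Qed.

Lemma gs_normalP A : gs_pos A -> triangular_frame A (gs_normal A).
Proof.
move=> A_pos; have /unit_upperP[u1 u2] := unit_upper_gs A n.
split=> [i j ji|i|k j kj]; first by rewrite mxE u1// mul0r.
  by rewrite mxE u2 mul1r invr_gt0 sqrtr_gt0.
rewrite gs_normalE congr_diag_entry [_ 0 k]mxE [_ 0 j]mxE.
move: kj; rewrite leq_eqVlt => /predU1P[/val_inj<-|kj]; last first.
  rewrite gs_orth// ?mulr0 -?val_eqE/= ?ltn_eqF// => l _.
  by rewrite gt_eqF.
rewrite pivotE 1?ltnW// -invfM -expr2 sqr_sqrtr ?ltW// mulVf ?eqxx//.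
by rewrite gt_eqF.
Qed.

(** Dividing each column of [W] by its diagonal entry gives a unit upper solution, hence the output
    of the process. Its pivots are the inverse squares of the diagonal entries of [W], so they are
    positive and normalization restores [W]. *)
Lemma gs_normal_uniq A W : triangular_frame A W -> gs_pos A /\ gs_normal A = W.
Proof.
move=> [uW W_gt0 WA]; pose d : 'rV[R]_n := \row_j (W j j)^-1.
have dW k j : ((W *m diag_mx d)^T *m A k *m (W *m diag_mx d)) k j =
    (W k k)^-1 * (W j j)^-1 * (W^T *m A k *m W) k j.
  by rewrite congr_diag_entry !mxE.
have uWd : unit_upper (W *m diag_mx d).
  apply/unit_upperP; split=> [i j ji|i]; rewrite mul_mx_diag !mxE.
    by rewrite uW// mul0r.
  by rewrite mulfV// gt_eqF.
have Wd0 (k j : 'I_n) : (k < j)%N ->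
    ((W *m diag_mx d)^T *m A k *m (W *m diag_mx d)) k j = 0.
  by move=> kj; rewrite dW WA ?(ltnW kj)// -val_eqE/= ltn_eqF ?mulr0.
have Wdd k : ((W *m diag_mx d)^T *m A k *m (W *m diag_mx d)) k k = (W k k) ^- 2.
  by rewrite dW WA// eqxx mulr1 -invfM.
have Wdd0 k : ((W *m diag_mx d)^T *m A k *m (W *m diag_mx d)) k k != 0.
  by rewrite Wdd invr_eq0 expf_neq0// gt_eqF.
have piv k : gs_pivot A k = (W k k) ^- 2.
  by rewrite (gs_pivot_uniq uWd Wd0 Wdd0) Wdd.
split=> [k|]; first by rewrite piv invr_gt0 exprn_gt0.
apply/matrixP => i j; rewrite mxE (gs_uniq uWd Wd0 Wdd0) mul_mx_diag !mxE piv.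
rewrite sqrtrV ?sqr_ge0// sqrtr_sqr gtr0_norm// invrK divfK//.
by rewrite gt_eqF.
Qed.

End Normalization.

(** * The chart and its inverse *)

Section EigenProjection.
Variables (R : realType) (n : nat).
Implicit Types (lam : 'rV[R]_n) (L Q X W : 'M[R]_n).

(* Lagrange interpolation at the eigenvalues; the repeated factors coming from
   multiple eigenvalues are harmless, since the factors not killing the
   eigenspace of [lam i] act on it as the identity. *)
Definition eigenproj lam X (i : 'I_n) : 'M[R]_n :=
  foldr (fun k M =>
      (lam ord0 i - lam ord0 k)^-1 *: ((X - (lam ord0 k)%:M) *m M))
    1%:M [seq k <- enum 'I_n | lam ord0 k != lam ord0 i].

(** The spectral projection of [diag_mx lam] for the eigenvalue [lam ord0 i]. *)
Definition eigenblock lam (i : 'I_n) : 'M[R]_n :=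
  diag_mx (\row_j (lam ord0 j == lam ord0 i)%:R).

Lemma eigenproj_conj lam Q i : Q^T *m Q = 1%:M ->
  eigenproj lam (Q^T *m diag_mx lam *m Q) i = Q^T *m eigenblock lam i *m Q.
Proof.
move=> QQ; have QQ' := mulmx1C QQ.
pose f k j := (lam ord0 i - lam ord0 k)^-1 * (lam ord0 j - lam ord0 k).
have H s : foldr (fun k M => (lam ord0 i - lam ord0 k)^-1 *:
      ((Q^T *m diag_mx lam *m Q - (lam ord0 k)%:M) *m M)) 1%:M s =
    Q^T *m diag_mx (\row_j \prod_(k <- s) f k j) *m Q.
  elim: s => [|k s IHs] /=.
    rewrite (_ : \row_j _ = const_mx 1); first by rewrite diag_const_mx mulmx1.
    by apply/rowP => j; rewrite !mxE big_nil.
  rewrite IHs -[(lam ord0 k)%:M]mulmx1 -QQ.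
  have -> : (lam ord0 k)%:M *m (Q^T *m Q) = Q^T *m (lam ord0 k)%:M *m Q.
    by rewrite mulmxA scalar_mxC.
  rewrite -mulmxBl -mulmxBr -!mulmxA (mulmxA Q) QQ' mul1mx.
  rewrite scalemxAr (mulmxA (_ - _)) scalemxAl; congr (_ *m (_ *m _)).
  have -> : diag_mx lam - (lam ord0 k)%:M =
      diag_mx (\row_j (lam ord0 j - lam ord0 k)).
    by apply/matrixP => a b; rewrite !mxE; case: eqP => [->|]; rewrite ?subr0.
  rewrite mul_diag_mx; apply/matrixP => a b; rewrite !mxE big_cons.
  by rewrite /f; case: eqP => _; rewrite ?mulr0n ?mulr0// !mulr1n mulrA.
rewrite /eigenproj H; congr (_ *m diag_mx _ *m _).
apply/rowP => j; rewrite !mxE big_filter big_enum_cond/=.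
(* On the eigenspace of [lam ord0 i] every factor is 1; elsewhere [j] itself belongs to the list and
   contributes the factor 0. *)
case: eqP => [ji|/eqP ji].
  apply: big1 => k; rewrite /f ji => ki; rewrite mulVf// subr_eq0 eq_sym//.
by rewrite (bigD1 j)//= {1}/f subrr mulr0 mul0r.
Qed.

(** The entry is a sum of [L k i * L k j] over the indices [k] with the eigenvalue of [i], and the
    vanishing condition of L^Lambda leaves only [k = i]. *)
Lemma congr_blockE lam L i j : unit_lower_at lam L ->
  (L^T *m eigenblock lam i *m L) i j = L i j.
Proof.
move=> [[/is_trig_mxP trL L1] L0].
rewrite -mulmxA mul_diag_mx mxE (bigD1 i)//= !mxE eqxx L1 !mul1r big1 ?addr0//.
move=> k ki; rewrite !mxE; case: eqP => [e|_]; last by rewrite mul0r mulr0.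
by rewrite L0// mul0r.
Qed.

(** The orthogonal factor of the QR decomposition of [L]; the [gs_normal] term is the inverse of the
    triangular factor. *)
Definition orth_factor L : 'M[R]_n := L *m gs_normal (fun=> L^T *m L).

(** Each pivot is the squared norm of a column of the invertible matrix [L *m V]. *)
Lemma gs_pos_gram L : L \in unitmx -> gs_pos (fun=> L^T *m L).
Proof.
move=> uL k; rewrite /gs_pivot; set V := gs _ k.
have uLV : L *m V \in unitmx.
  by rewrite unitmx_mul uL unit_upper_unit//; exact: unit_upper_gs.
have -> : V^T *m (L^T *m L) *m V = (L *m V)^T *m (L *m V).
  by rewrite trmx_mul !mulmxA.
rewrite mxE lt_neqAle eq_sym; apply/andP; split; last first.
  by apply: sumr_ge0 => i _; rewrite mxE -expr2 sqr_ge0.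
apply/eqP => /psumr_eq0P => H.
have {}H i : (L *m V) i k = 0.
  have := H _ i isT; rewrite mxE => E.
  apply/eqP; rewrite -sqrf_eq0 expr2 E// => l _.
  by rewrite mxE -expr2 sqr_ge0.
have /matrixP/(_ k k) := mulVmx uLV; rewrite mxE big1 => [|i _].
  by rewrite mxE eqxx => /eqP; rewrite eq_sym oner_eq0.
by rewrite H mulr0.
Qed.

Lemma orth_factorP L : gs_pos (fun=> L^T *m L) ->
  (orth_factor L)^T *m orth_factor L = 1%:M.
Proof.
move=> /gs_normalP[_ _]; set W := gs_normal _ => H.
have E : (orth_factor L)^T *m orth_factor L = W^T *m (L^T *m L) *m W.
  by rewrite /orth_factor trmx_mul !mulmxA.
apply/matrixP => i j; rewrite [RHS]mxE; case: (leqP i j) => [ij|/ltnW ij].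
  by rewrite E H.
have -> : ((orth_factor L)^T *m orth_factor L) i j =
    ((orth_factor L)^T *m orth_factor L)^T j i by rewrite [RHS]mxE.
by rewrite trmx_mul trmxK E H// eq_sym.
Qed.

Lemma triangular_frame_inv W : upper_mx W -> (forall i, 0 < W i i) ->
  upper_mx (invmx W) /\ (forall i, 0 < invmx W i i).
Proof.
move=> uW W0; have W0' i : W i i != 0 by rewrite gt_eqF.
split=> [|i]; first exact: upper_mx_inv.
by rewrite upper_mx_inv_diag// invr_gt0.
Qed.

(** Uniqueness of the QR decomposition: [invmx W] is a triangular frame for the constant form
    [L^T *m L]. *)
Lemma orth_factor_uniq Q W L : upper_mx W -> (forall i, 0 < W i i) ->
  Q^T *m Q = 1%:M -> Q *m W = L -> orth_factor L = Q.
Proof.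
move=> uW W0 QQ QW; have [uV V0] := triangular_frame_inv uW W0.
have Wu : W \in unitmx by apply: upper_unitmx => // i; rewrite gt_eqF.
have LV : L *m invmx W = Q by rewrite -QW mulmxK.
have [|_] := @gs_normal_uniq _ _ (fun=> L^T *m L) (invmx W).
  split=> // k j _.
  have -> : (invmx W)^T *m (L^T *m L) *m invmx W =
      (L *m invmx W)^T *m (L *m invmx W).
    by rewrite trmx_mul !mulmxA.
  by rewrite LV QQ mxE.
by rewrite /orth_factor => ->.
Qed.

Lemma unit_lower_unitmx L : unit_lower L -> \det L = 1 /\ L \in unitmx.
Proof.
move=> [trL L1]; have dL : \det L = 1 by rewrite det_trig// big1.
by rewrite unitmxE dL unitr1.
Qed.

Lemma det_orth_gt0 Q : Q^T *m Q = 1%:M -> 0 < \det Q -> SO Q.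
Proof.
move=> QQ Q0; split=> //; have /eqP := congr1 determinant QQ.
rewrite det_mulmx det_tr det1 -expr2 sqrf_eq1 => /orP[/eqP//|/eqP] Q1.
by move: Q0; rewrite Q1 oppr_gt0 ltr10.
Qed.

Lemma orth_factor_SO L : unit_lower L -> SO (orth_factor L).
Proof.
move=> /unit_lower_unitmx[dL uL]; apply: det_orth_gt0.
  exact/orth_factorP/gs_pos_gram.
have [uW W0 _] := gs_normalP (gs_pos_gram uL).
by rewrite det_mulmx dL mul1r det_upper//; apply: prodr_gt0.
Qed.

(* [W] is the inverse of the factor [U] of the frame [Q = L U]. *)
Definition chart lam X : 'M[R]_n :=
  let W := gs_normal (eigenproj lam X) in
  \matrix_(i, j) (W^T *m eigenproj lam X i *m W) i j.

Definition chart_inv lam L : 'M[R]_n :=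
  (orth_factor L)^T *m diag_mx lam *m orth_factor L.

(** With [L = Q V] the QR decomposition, the congruence by [V] carries the eigenprojections of
    [chart_inv lam L] to forms whose relevant entries are those of [L]. As [L] is unit lower
    triangular, [V] is the triangular frame, and the chart reads off [L]. *)
Lemma chart_invK lam L : unit_lower_at lam L ->
  gs_pos (eigenproj lam (chart_inv lam L)) /\ chart lam (chart_inv lam L) = L.
Proof.
move=> lL; have [_ uL] := unit_lower_unitmx lL.1.
have [] := gs_normalP (gs_pos_gram uL).
set W := gs_normal _ => uW W0 _; have [uV V0] := triangular_frame_inv uW W0.
have Wu : W \in unitmx by apply: upper_unitmx => // i; rewrite gt_eqF.
have QV : orth_factor L *m invmx W = L by rewrite mulmxK.
have E i j :
    ((invmx W)^T *m eigenproj lam (chart_inv lam L) i *m invmx W) i j = L i j.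
  rewrite eigenproj_conj ?orth_factorP//; last exact: gs_pos_gram.
  have -> : (invmx W)^T *m
      ((orth_factor L)^T *m eigenblock lam i *m orth_factor L) *m invmx W =
      (orth_factor L *m invmx W)^T *m eigenblock lam i *m
      (orth_factor L *m invmx W).
    by rewrite [(orth_factor L *m _)^T]trmx_mul !mulmxA.
  by rewrite QV congr_blockE.
have [|P P'] := @gs_normal_uniq _ _ (eigenproj lam (chart_inv lam L)) (invmx W).
  split=> // i j; rewrite E leq_eqVlt => /predU1P[/val_inj->|ij].
    by rewrite lL.1.2 eqxx.
  by have /is_trig_mxP-> := lL.1.1; rewrite // -val_eqE/= ltn_eqF.
by split=> //; apply/matrixP => i j; rewrite mxE P' E.
Qed.

End EigenProjection.

(** * Reconstruction of a matrix from a frame adapted to its eigenprojections *)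

Section EigenFrame.
Variables (R : realType) (n : nat) (lam : 'rV[R]_n) (X : 'M[R]_n).
Variable A : 'I_n -> 'M[R]_n.
Hypothesis A_sym : forall i, (A i)^T = A i.
Hypothesis A_eq : forall i j, lam ord0 i = lam ord0 j -> A i = A j.
Hypothesis A_idem : forall i, A i *m A i = A i.
Hypothesis A_ortho : forall i j, lam ord0 i != lam ord0 j -> A i *m A j = 0.
Hypothesis A_eigen : forall i, A i *m X = lam ord0 i *: A i.
Hypothesis A_pos : gs_pos A.

Let W := gs_normal A.
Let L : 'M[R]_n := \matrix_(i, j) (W^T *m A i *m W) i j.
Let Q : 'M[R]_n := \matrix_(i, j) (W^T *m A i) i j.

(** The rows [w_i^T A_i] of [Q] are orthonormal: across eigenvalues because the projections
    annihilate each other, within one by the frame relations. They are left eigenvectors of [X], and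
    [Q *m W = L] is a QR decomposition up to inverting [W]. The family [A] is kept abstract so that
    it can also be a list of projections in an order still to be found. *)
Lemma eigenframe : unit_lower_at lam L /\ chart_inv lam L = X.
Proof.
have [uW W0 WA] := gs_normalP A_pos; rewrite -/W in uW W0 WA.
have WAsym k i j : (W^T *m A k *m W) i j = (W^T *m A k *m W) j i.
  by rewrite -[in LHS](A_sym k) -[in LHS](trmxK W) -!trmx_mul mulmxA mxE trmxK.
(* Equal eigenvalues give the same symmetric form, so the frame relations extend below the
   diagonal. *)
have Lij i j : lam ord0 i = lam ord0 j -> (W^T *m A i *m W) i j = (i == j)%:R.
  move=> e; case: (leqP i j) => [/WA//|/ltnW ji].
  by rewrite (A_eq e) WAsym WA// eq_sym.
have QW : Q *m W = L.
  by apply/matrixP => i j; rewrite !mxE; apply: eq_bigr => k _; rewrite !mxE.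
have QQ : Q *m Q^T = 1%:M.
  apply/matrixP => i j; rewrite [RHS]mxE.
  have -> : (Q *m Q^T) i j = (W^T *m (A i *m A j) *m W) i j.
    have -> : W^T *m (A i *m A j) *m W = (W^T *m A i) *m (W^T *m A j)^T.
      by rewrite trmx_mul trmxK A_sym !mulmxA.
    by rewrite !mxE; apply: eq_bigr => k _; rewrite !mxE.
  case: (eqVneq (lam ord0 i) (lam ord0 j)) => e.
    by rewrite -(A_eq e) A_idem Lij.
  rewrite A_ortho// mulmx0 mul0mx mxE; case: eqP => // ij.
  by rewrite ij eqxx in e.
have QX : Q *m X = diag_mx lam *m Q.
  apply/matrixP => i j; rewrite mul_diag_mx [RHS]mxE.
  have -> : (Q *m X) i j = (W^T *m A i *m X) i j.
    by rewrite !mxE; apply: eq_bigr => k _; rewrite !mxE.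
  by rewrite -mulmxA A_eigen -scalemxAr mxE [Q _ _]mxE.
have QQ' := mulmx1C QQ.
split.
  split; first split.
  - apply/is_trig_mxP => i j ij.
    by rewrite mxE WA ?(ltnW ij)// -val_eqE/= ltn_eqF.
  - by move=> i; rewrite mxE Lij// eqxx.
  - by move=> i j e /negPf ij; rewrite mxE Lij// ij.
rewrite /chart_inv (orth_factor_uniq uW W0 QQ' QW) -mulmxA -QX mulmxA QQ'.
by rewrite mul1mx.
Qed.

End EigenFrame.

(** * Covering *)

Section SpectralTheorem.
Import sesquilinear spectral complex.

(** Over the complex numbers [X] is Hermitian, hence unitarily diagonalizable with real eigenvalues;
    real matrices similar over the complex numbers are similar over the reals. The [P] so obtained
    is invertible but possibly not orthogonal. *)
Lemma real_symmetric_diagonalizable (R : realType) n (X : 'M[R]_n) : X^T = X ->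
  exists P (d : 'rV[R]_n), P \in unitmx /\ P *m X = diag_mx d *m P.
Proof.
move=> symX; pose C : numClosedFieldType := complex.complex R.
pose inj : {rmorphism R -> C} := complex.real_complex R.
pose re : C -> R := @complex.Re R.
have real_inj x : inj x \is Num.real by apply/complex.complex_realP; exists x.
have map_re m p (M : 'M[C]_(m, p)) :
    M \is a mxOver Num.real -> map_mx inj (map_mx re M) = M.
  move=> /mxOverP M_real; apply/matrixP => i j; rewrite !mxE.
  exact/complex.RRe_real/M_real.
pose A := map_mx inj X.
have A_real : A \is a mxOver Num.real.
  by apply/mxOverP => i j; rewrite mxE.
have A_herm : A \is hermsymmx.
  apply: realsym_hermsym => //; rewrite qualifE; apply/eqP.
  by rewrite expr0 scale1r map_mx_id// /A map_trmx symX.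
have A_spec := orthomx_spectralP (hermitian_normalmx A_herm).
have D_real : spectral_diag A \is a mxOver Num.real.
  exact: hermitian_spectral_diag_real.
have uP := spectral_unit A.
have [|||P] := @real_similar _ _ A (diag_mx (spectral_diag A)).
- exists (spectralmx A) => //; apply/similarP => //.
  by rewrite {2}A_spec !mulmxA mulmxV// mul1mx.
- exact: A_real.
- apply/mxOverP => i j; rewrite mxE; case: eqP => _; rewrite ?mulr0n// mulr1n.
  exact/mxOverP.
rewrite inE => /andP[P_real P_unit] /similarP => /(_ P_unit) simP.
exists (map_mx re P), (map_mx re (spectral_diag A)).
have injK : injective (@map_mx R C inj n n).
  move=> M N /matrixP MN; apply/matrixP => i j; have := MN i j.
  by rewrite !mxE => /complexI.
split; first by rewrite -(map_unitmx inj) map_re.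
apply: injK; rewrite !map_mxM/= map_diag_mx !map_re//.
Qed.

End SpectralTheorem.

(** * Choice of the order of the eigenvalues *)

Section Cover.
Variables (R : realType) (n : nat).
Implicit Types (lam : 'rV[R]_n) (L Q X W P V : 'M[R]_n).

Lemma gram_gt0 V i k : V i k != 0 -> 0 < (V^T *m V) k k.
Proof.
move=> Vik; rewrite mxE (bigD1 i)//= mxE -expr2 ltr_pwDl ?exprn_even_gt0//.
by apply: sumr_ge0 => j _; rewrite mxE -expr2 sqr_ge0.
Qed.

Lemma unitmx_col_neq0 V k : V \in unitmx -> exists i, V i k != 0.
Proof.
move=> uV; apply/existsP; apply: contraT => /existsPn V0.
have /matrixP/(_ k k) := mulVmx uV; rewrite !mxE big1 => [|i _].
  by rewrite eqxx => /eqP; rewrite eq_sym oner_eq0.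
by have /negPn/eqP-> := V0 i; rewrite mulr0.
Qed.

Lemma eigenblock_mul lam i j : eigenblock lam i *m eigenblock lam j =
  if lam ord0 i == lam ord0 j then eigenblock lam i else 0.
Proof.
rewrite mulmx_diag; case: ifP => [/eqP ij|ij].
  congr diag_mx; apply/rowP => k; rewrite !mxE ij.
  by case: eqP => _; rewrite ?mulr1 ?mulr0.
apply/matrixP => a b; rewrite !mxE.
case: (eqVneq a b) => [_|]; rewrite ?mulr0n//.
case: eqP => [->|]; rewrite ?mul0r ?mul0rn//.
by rewrite ij mulr0 mul0rn.
Qed.

Lemma symmetric_chart X : X^T = X ->
  exists lam L, unit_lower_at lam L /\ chart_inv lam L = X.
Proof.
move=> symX; have [P [d [uP PX]]] := real_symmetric_diagonalizable symX.
pose B i := invmx P *m eigenblock d i *m P.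
have PB i : P *m B i = eigenblock d i *m P by rewrite /B -mulmxA mulKVmx.
have B_idem i : B i *m B i = B i.
  by rewrite {1}/B -mulmxA PB mulmxA -(mulmxA (invmx P)) eigenblock_mul eqxx.
have B_ortho i j : d ord0 i != d ord0 j -> B i *m B j = 0.
  move=> ij; rewrite {1}/B -mulmxA PB mulmxA -(mulmxA (invmx P)) eigenblock_mul.
  by rewrite (negPf ij) mulmx0 mul0mx.
have B_eigen i : B i *m X = d ord0 i *: B i.
  rewrite /B -mulmxA PX mulmxA scalemxAl scalemxAr -(mulmxA (invmx P)).
  congr (_ *m _ *m _); rewrite mulmx_diag -linearZ/=; congr diag_mx.
  apply/rowP => k; rewrite !mxE; case: eqP => [->|]; rewrite ?mulr1 ?mul1r//.
  by rewrite mulr0 mul0r.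
(* [P] is only known to be invertible, so symmetry comes from [X]: it makes [P *m P^T] commute with
   [diag_mx d], hence with each eigenblock. *)
have B_sym i : (B i)^T = B i.
  have S_comm a b : d ord0 a * (P *m P^T) a b = (P *m P^T) a b * d ord0 b.
    have : diag_mx d *m (P *m P^T) = (P *m P^T) *m diag_mx d.
      rewrite mulmxA -PX -{1}symX -[P in LHS]trmxK -!trmx_mul trmxK mulmxA PX.
      by rewrite !trmx_mul trmxK tr_diag_mx mulmxA.
    by move=> /matrixP/(_ a b); rewrite mul_diag_mx mul_mx_diag !mxE.
  have SE : (P *m P^T) *m eigenblock d i = eigenblock d i *m (P *m P^T).
    move: (P *m P^T) S_comm => S S_comm.
    apply/matrixP => a b; rewrite mul_mx_diag mul_diag_mx !mxE.
    have [->|Sab] := eqVneq (S a b) 0; first by rewrite mul0r mulr0.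
    have -> : d ord0 a = d ord0 b by apply: (mulfI Sab); rewrite mulrC.
    by rewrite mulrC.
  have uPT : P^T \in unitmx by rewrite unitmx_tr.
  apply: (can_inj (mulKmx uP)); apply: (can_inj (mulmxK uPT)).
  rewrite PB -[RHS]mulmxA -SE.
  by rewrite /B !trmx_mul tr_diag_mx trmx_inv -!mulmxA mulVmx// mulmx1.
(* The eigenvalue [d (s k)] is chosen so that the [k]-th pivot is positive. *)
have greedy m : (m <= n)%N -> exists s : 'I_n -> 'I_n,
    forall k : 'I_n, (k < m)%N -> 0 < gs_pivot (B \o s) k.
  elim: m => [_|m IHm mn]; first by exists id.
  have [s s_pos] := IHm (ltnW mn); pose l := Ordinal mn.
  have [|i PVi] := @unitmx_col_neq0 (P *m gs (B \o s) m) l.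
    by rewrite unitmx_mul uP unit_upper_unit//; exact: unit_upper_gs.
  pose s' k := if k == l then i else s k; exists s' => k.
  rewrite ltnS leq_eqVlt => /predU1P[kl|km]; last first.
    rewrite (@eq_gs_pivot _ _ _ (B \o s)) ?s_pos// => j jk.
    by rewrite /s' /= -val_eqE/= ltn_eqF// (leq_ltn_trans jk).
  have {kl}-> : k = l by exact: val_inj.
  rewrite /gs_pivot (@eq_gs _ _ _ (B \o s)) => [|j jl]; last first.
    by rewrite /s' /= -val_eqE/= ltn_eqF.
  rewrite /= /s' eqxx; set V := gs _ _.
  have -> : V^T *m B i *m V = (B i *m V)^T *m (B i *m V).
    by rewrite trmx_mul B_sym mulmxA -(mulmxA _ (B i) (B i)) B_idem.
  (* Row [i] of [P *m B i] is row [i] of [P], so [B i] cannot kill a column [v] for which entry [i]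
     of [P *m v] is nonzero. *)
  have [j BVj] : exists j, (B i *m V) j l != 0.
    apply/existsP; apply: contraNT PVi => /existsPn BV0.
    have : (P *m (B i *m V)) i l = 0.
      by rewrite mxE big1// => j _; have /negPn/eqP-> := BV0 j; rewrite mulr0.
    rewrite mulmxA PB -mulmxA mul_diag_mx mxE [X in X * _]mxE eqxx mul1r.
    by move=> ->.
  exact: gram_gt0 BVj.
have [s s_pos] := greedy n (leqnn n).
(* The greedy choice does not make [s] a permutation by construction; the conjugacy of [X] to
   [diag_mx lam] given by [eigenframe] forces the right multiplicities. *)
pose lam : 'rV[R]_n := \row_k d ord0 (s k).
have lamE k : lam ord0 k = d ord0 (s k) by rewrite mxE.
have Beq i j : d ord0 i = d ord0 j -> B i = B j.
  move=> ij; rewrite /B; congr (_ *m diag_mx _ *m _).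
  by apply/rowP => k; rewrite !mxE ij.
have := @eigenframe _ _ lam X (B \o s); move=> H.
eexists; eexists; apply: H => //=.
- by move=> i j; rewrite !lamE => /Beq.
- by move=> i j; rewrite !lamE => /B_ortho.
- by move=> i; rewrite lamE.
- by move=> k; exact: s_pos.
Qed.

Lemma orth_conj_diag lam1 lam2 Q : Q^T *m Q = 1%:M ->
  diag_mx lam1 = Q^T *m diag_mx lam2 *m Q ->
  forall i, exists k, lam1 ord0 i = lam2 ord0 k.
Proof.
move=> QQ E i; have QQ' := mulmx1C QQ.
have uQ : Q \in unitmx by have [] := mulmx1_unit QQ.
have [k Qki] := unitmx_col_neq0 i uQ; exists k.
have : (Q *m diag_mx lam1) k i = (diag_mx lam2 *m Q) k i.
  by rewrite E !mulmxA QQ' mul1mx.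
by rewrite mul_mx_diag mul_diag_mx !mxE mulrC => /(mulIf Qki).
Qed.

Lemma orth_classP X0 X Q : orth_class X0 X -> SO Q ->
  orth_class X0 (Q^T *m X *m Q).
Proof.
move=> [P [PP dP] <-] [QQ dQ].
exists (P *m Q); last by rewrite trmx_mul !mulmxA.
split; last by rewrite det_mulmx dP dQ mulr1.
by rewrite trmx_mul -mulmxA (mulmxA P^T) PP mul1mx.
Qed.

Lemma orth_class_trans X0 X Q : SO Q -> orth_class X0 (Q^T *m X *m Q) ->
  orth_class X0 X.
Proof.
move=> [QQ dQ]; have QQ' := mulmx1C QQ.
move=> /orth_classP => /(_ Q^T); rewrite trmxK => H.
have := H _; rewrite -!mulmxA QQ' mulmx1 mulmxA QQ' mul1mx; apply.
by split; rewrite ?det_tr// trmxK.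
Qed.

(** Conjugate diagonal matrices have the same eigenvalues, so each one in the class is a selection,
    indexed by a map of ['I_n] to itself, from the entries of a fixed one. *)
Lemma finite_orth_class_diag X0 :
  finite_set [set lam : 'rV[R]_n | orth_class X0 (diag_mx lam)].
Proof.
have [H|] := pselect (exists lam0 : 'rV[R]_n, orth_class X0 (diag_mx lam0));
    last first.
  move=> H; apply: sub_finite_set (finite_set0 _) => lam lamX.
  by apply: H; exists lam.
case: H => [lam0 [Q0 [QQ0 dQ0] E0]].
apply: (@sub_finite_set _ _
  (range (fun f : {ffun 'I_n -> 'I_n} => \row_i lam0 ord0 (f i)))).
  move=> lam [Q [QQ dQ] E].
  have QQ0' := mulmx1C QQ0.
  have := @orth_conj_diag lam lam0 (Q0^T *m Q).
  have -> : (Q0^T *m Q)^T *m (Q0^T *m Q) = 1%:M.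
    by rewrite trmx_mul trmxK -mulmxA (mulmxA Q0) QQ0' mul1mx.
  have -> : (Q0^T *m Q)^T *m diag_mx lam0 *m (Q0^T *m Q) = diag_mx lam.
    rewrite -E -E0 trmx_mul trmxK !mulmxA -(mulmxA _ Q0) QQ0' mulmx1.
    by rewrite -(mulmxA _ Q0) QQ0' mulmx1.
  move=> /(_ erefl erefl) /choice[f fE]; exists [ffun i => f i] => //.
  by apply/rowP => i; rewrite mxE ffunE -fE.
exact/finite_image/finite_finset.
Qed.

End Cover.

(** * Regularity *)

Section RationalClosure.
Variables (R : realType) (T : Type) (S : set T).
Implicit Types (C : (T -> R) -> Prop) (f g : T -> R).

(* Closure under inversion is only required of the functions that do not
   vanish on [S]: the choice of [S] makes this fit germs at a point as well as
   functions on an open set. *)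
Record rational_closed C : Prop := RationalClosed {
  rclosed_cst : forall c, C (fun=> c);
  rclosedD : forall f g, C f -> C g -> C (fun x => f x + g x);
  rclosedM : forall f g, C f -> C g -> C (fun x => f x * g x);
  rclosedV : forall f, C f -> (forall x, S x -> f x != 0) ->
    C (fun x => (f x)^-1) }.

Variables (C : (T -> R) -> Prop) (C_rat : rational_closed C).

Let C_cst := rclosed_cst C_rat.
Let C_add := rclosedD C_rat.
Let C_mul := rclosedM C_rat.
Let C_inv := rclosedV C_rat.

Lemma rclosedB f g : C f -> C g -> C (fun x => f x - g x).
Proof.
move=> Cf Cg; have := C_add Cf (C_mul (C_cst (-1)) Cg).
by congr C; apply/funext => x /=; rewrite mulN1r.
Qed.

Lemma rclosed_sum I (r : seq I) (P : pred I) (F : I -> T -> R) :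
  (forall i, C (F i)) -> C (fun x => \sum_(i <- r | P i) F i x).
Proof.
move=> CF; elim: r => [|i r IHr].
  by under eq_fun do rewrite big_nil; exact: C_cst.
by under eq_fun do rewrite big_cons; case: (P i) => //; exact: C_add.
Qed.

Lemma rclosed_prod I (r : seq I) (P : pred I) (F : I -> T -> R) :
  (forall i, C (F i)) -> C (fun x => \prod_(i <- r | P i) F i x).
Proof.
move=> CF; elim: r => [|i r IHr].
  by under eq_fun do rewrite big_nil; exact: C_cst.
by under eq_fun do rewrite big_cons; case: (P i) => //; exact: C_mul.
Qed.

Definition entries_in m p (F : T -> 'M[R]_(m, p)) :=
  forall i j, C (fun x => F x i j).

Lemma entries_in_cst m p (M : 'M[R]_(m, p)) : entries_in (fun=> M).
Proof. by move=> i j; exact: C_cst. Qed.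

Lemma entries_in_tr m p (F : T -> 'M[R]_(m, p)) :
  entries_in F -> entries_in (fun x => (F x)^T).
Proof. by move=> CF i j; under eq_fun do rewrite mxE; exact: CF. Qed.

Lemma entries_inM m p q (F : T -> 'M[R]_(m, p)) (G : T -> 'M[R]_(p, q)) :
  entries_in F -> entries_in G -> entries_in (fun x => F x *m G x).
Proof.
move=> CF CG i j; under eq_fun do rewrite mxE.
by apply: rclosed_sum => k; exact: C_mul.
Qed.

Lemma entries_inD m p (F G : T -> 'M[R]_(m, p)) :
  entries_in F -> entries_in G -> entries_in (fun x => F x + G x).
Proof. by move=> CF CG i j; under eq_fun do rewrite mxE; exact: C_add. Qed.

Lemma entries_inB m p (F G : T -> 'M[R]_(m, p)) :
  entries_in F -> entries_in G -> entries_in (fun x => F x - G x).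
Proof. by move=> CF CG i j; under eq_fun do rewrite !mxE; exact: rclosedB. Qed.

Lemma entries_inZ m p f (F : T -> 'M[R]_(m, p)) :
  C f -> entries_in F -> entries_in (fun x => f x *: F x).
Proof. by move=> Cf CF i j; under eq_fun do rewrite mxE; exact: C_mul. Qed.

Lemma rclosed_det m (F : T -> 'M[R]_m) :
  entries_in F -> C (fun x => \det (F x)).
Proof.
move=> CF; apply: rclosed_sum => s; apply: C_mul; first exact: C_cst.
by apply: rclosed_prod => i; exact: CF.
Qed.

Lemma entries_in_adj m (F : T -> 'M[R]_m) :
  entries_in F -> entries_in (fun x => \adj (F x)).
Proof.
move=> CF i j; under eq_fun do rewrite mxE; apply: C_mul; first exact: C_cst.
by apply: rclosed_det => a b; under eq_fun do rewrite !mxE; exact: CF.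
Qed.

Lemma entries_in_inv m (F : T -> 'M[R]_m) : entries_in F ->
    (forall x, S x -> \det (F x) != 0) ->
  entries_in (fun x => (\det (F x))^-1 *: \adj (F x)).
Proof.
move=> CF F0; apply: entries_inZ; last exact: entries_in_adj.
by apply: C_inv => //; exact: rclosed_det.
Qed.

Variables (n : nat) (A : T -> 'I_n -> 'M[R]_n).
Hypothesis CA : forall i, entries_in (fun x => A x i).
Hypothesis A_piv : forall x, S x -> forall k, gs_pivot (A x) k != 0.

Lemma entries_in_congr (F G : T -> 'M[R]_n) : entries_in F -> entries_in G ->
  entries_in (fun x => (F x)^T *m G x *m F x).
Proof.
move=> CF CG; apply: entries_inM => //; apply: entries_inM => //.
exact: entries_in_tr.
Qed.

Lemma entries_in_gs m : entries_in (fun x => gs (A x) m).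
Proof.
elim: m => [|m IHm]; first exact: entries_in_cst.
rewrite /=; case: insubP => [k _ km|_]; last exact: IHm.
have CG := entries_in_congr IHm (CA k).
move=> i j; under eq_fun do rewrite mxE.
apply: rclosedB; first exact: IHm.
apply: C_mul; last exact: IHm.
case: (k < j)%N; last exact: C_cst.
apply: C_mul; first exact: CG.
apply: C_inv => [|x Sx]; first exact: CG.
by have := A_piv Sx k; rewrite /gs_pivot -[nat_of_ord k]/(val k) km.
Qed.

Lemma rclosed_pivot k : C (fun x => gs_pivot (A x) k).
Proof. by apply: entries_in_congr => //; exact: entries_in_gs. Qed.

Hypothesis C_sqrt : forall f, C f -> (forall x, S x -> 0 < f x) ->
  C (fun x => (Num.sqrt (f x))^-1).
Hypothesis A_pos : forall x, S x -> gs_pos (A x).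

(** Square roots enter only here; [gs] and its pivots are rational, which keeps them within reach of
    the density argument. *)
Lemma entries_in_gs_normal : entries_in (fun x => gs_normal (A x)).
Proof.
move=> i j; under eq_fun do rewrite mxE.
apply: C_mul; first exact: entries_in_gs.
by apply: C_sqrt => [|x Sx]; [exact: rclosed_pivot|exact: A_pos].
Qed.

End RationalClosure.

(** * Calculus of class C^k functions *)

Section CkCalculus.
Variables (R : realType).

Section Generic.
Variables (V : normedModType R) (U : set V).
Hypothesis openU : open U.

Lemma near_eq_diff (W : normedModType R) (f g : V -> W) x :
  (\forall y \near x, f y = g y) -> differentiable f x ->
  differentiable g x /\ 'd g x = 'd f x :> (V -> W).
Proof.
move=> fg df; have [df_cont fE] := (diff_locallyP _ _).1 df.
have gE : g \o shift x = cst (g x) + 'd f x +o_ (0 : V) id.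
  apply/eqaddoP => e e0.
  have /eqaddoP/(_ e e0) H := fE.
  have fg0 : \forall h \near (0 : V), f (h + x) = g (h + x).
    by have := fg; rewrite (near_shift 0) subr0.
  near=> h.
  have -> : (g \o shift x - (cst (g x) + 'd f x)) h =
            (f \o shift x - (cst (f x) + 'd f x)) h.
    rewrite !fctE/= (nbhs_singleton fg).
    by congr (_ - _); apply/esym; near: h.
  by near: h.
have dgE : 'd g x = 'd f x :> (V -> W) by exact: diff_unique.
split; last exact: dgE.
by apply/diff_locallyP; rewrite dgE; split; [exact: df_cont|exact: gE].
Unshelve. all: by end_near. Qed.

(** The rules of differentiation give ['d f x v] only for [x] in [U]; openness of [U] allows such
    formulas to be substituted inside [Ck]. *)
Lemma Ck_eq (W : normedModType R) k (f g : V -> W) :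
  (forall x, U x -> f x = g x) -> Ck k U f -> Ck k U g.
Proof.
have near_eq (W' : normedModType R) (f' g' : V -> W') x :
    (forall x, U x -> f' x = g' x) -> U x -> \forall y \near x, f' y = g' y.
  move=> fg Ux; have : nbhs x U by exact: open_nbhs_nbhs.
  by apply: filterS => y; exact: fg.
elim: k W f g => [|k IHk] W f g fg /=.
  move=> Cf x Ux; rewrite /prop_for /continuous_at -fg//.
  by apply: cvg_trans (Cf x Ux); apply: near_eq_cvg; exact: near_eq.
move=> [df Cdf].
have dfg x : U x -> differentiable g x /\ 'd g x = 'd f x :> (V -> W).
  by move=> Ux; apply: near_eq_diff; [exact: near_eq|exact: df].
split=> [x /dfg[]//|v]; apply: IHk (Cdf v) => x Ux.
by have [_ ->] := dfg x Ux.
Qed.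

Lemma CkW (W : normedModType R) k (f : V -> W) : Ck k.+1 U f -> Ck k U f.
Proof.
elim: k W f => [|k IHk] W f [df Cdf].
  by move=> x Ux; exact/differentiable_continuous/df.
by split=> // v; exact/IHk/Cdf.
Qed.

Lemma Ck_cst (W : normedModType R) k (w : W) : Ck k U (fun=> w).
Proof.
elim: k W w => [|k IHk] W w; first by move=> x Ux; exact: cst_continuous.
split=> [x _|v]; first exact: differentiable_cst.
by under eq_fun do rewrite (diff_cst w); exact: IHk.
Qed.

Lemma CkD (W : normedModType R) k (f g : V -> W) :
  Ck k U f -> Ck k U g -> Ck k U (fun x => f x + g x).
Proof.
elim: k W f g => [|k IHk] W f g.
  by move=> Cf Cg x Ux; apply: continuousD; [exact: Cf|exact: Cg].
move=> [df Cf] [dg Cg]; split=> [x Ux|v].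
  by apply: differentiableD; [exact: df|exact: dg].
apply: Ck_eq (IHk _ _ _ (Cf v) (Cg v)) => x Ux.
by rewrite diffD; [|exact: df|exact: dg].
Qed.

Lemma CkM k (f g : V -> R) :
  Ck k U f -> Ck k U g -> Ck k U (fun x => f x * g x).
Proof.
elim: k f g => [|k IHk] f g.
  by move=> Cf Cg x Ux; apply: continuousM; [exact: Cf|exact: Cg].
move=> Cf Cg; have [df Cdf] := Cf; have [dg Cdg] := Cg; split=> [x Ux|v].
  by apply: differentiableM; [exact: df|exact: dg].
have := CkD (IHk _ _ (CkW Cf) (Cdg v)) (IHk _ _ (CkW Cg) (Cdf v)).
by apply: Ck_eq => x Ux; rewrite diffM; [|exact: df|exact: dg].
Qed.

Lemma CkZl (W : normedModType R) k (f : V -> R) (w : W) :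
  Ck k U f -> Ck k U (fun x => f x *: w).
Proof.
elim: k f => [|k IHk] f.
  by move=> Cf x Ux; apply: continuousZr_tmp; exact: Cf.
move=> [df Cf]; split=> [x Ux|v]; first by apply: differentiableZl; exact: df.
apply: Ck_eq (IHk _ (Cf v)) => x Ux.
by rewrite diffZl; last exact: df.
Qed.

Lemma CkV k (f : V -> R) : Ck k U f -> (forall x, U x -> f x != 0) ->
  Ck k U (fun x => (f x)^-1).
Proof.
move=> + f0; elim: k => [|k IHk].
  by move=> Cf x Ux; apply: continuousV; [exact: f0|exact: Cf].
move=> Cf; have [df Cdf] := Cf; split=> [x Ux|v].
  by apply: differentiableV; [exact: df|exact: f0].
have Cf' := IHk (CkW Cf).
have := CkM (@Ck_cst R k (-1)) (CkM (CkM Cf' Cf') (Cdf v)).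
apply: Ck_eq => x Ux; rewrite diffV; [|exact: df|exact: f0].
by rewrite mulN1r -invfM -expr2 -mulNr.
Qed.

(* Meant for [g = sqrt f]: the derivative of [1/g] is a polynomial in [1/g] and
   the derivative of [f], which gains one order of regularity at a time. *)
Lemma CkV_of_halfderiv k (f g : V -> R) : Ck k U f ->
    (forall x, U x -> g x != 0) -> (forall x, U x -> differentiable g x) ->
    (forall x v, U x -> 'd g x v = 'd f x v * (2 * g x)^-1) ->
  Ck k U (fun x => (g x)^-1).
Proof.
move=> Cf g0 dg dgE; elim: k Cf => [|k IHk] Cf.
  move=> x Ux; apply: continuousV; first exact: g0.
  exact/differentiable_continuous/dg.
have [df Cdf] := Cf.
split=> [x Ux|v]; first by apply: differentiableV; [exact: dg|exact: g0].
have Ch := IHk (CkW Cf).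
have := CkM (@Ck_cst R k (- 2^-1)) (CkM (CkM Ch (CkM Ch Ch)) (Cdf v)).
apply: Ck_eq => x Ux.
have E : 'd (fun y => (g y)^-1) x v = - (g x) ^- 2 * 'd g x v.
  exact: (congr1 (@^~ v) (diffV (dg x Ux) (g0 x Ux))).
rewrite [RHS]E (dgE x v Ux); move: ('d f x v) => dfx.
by field; exact: g0.
Qed.

Lemma Ck_invsqrt k (f : V -> R) : Ck k U f -> (forall x, U x -> 0 < f x) ->
  Ck k U (fun x => (Num.sqrt (f x))^-1).
Proof.
case: k => [|k] Cf f_gt0; have s0 x : U x -> Num.sqrt (f x) != 0.
- by move=> Ux; rewrite gt_eqF// sqrtr_gt0 f_gt0.
- move=> x Ux; apply: continuousV; first exact: s0.
  by apply: continuous_comp; [exact: Cf|exact: sqrt_continuous].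
- by move=> Ux; rewrite gt_eqF// sqrtr_gt0 f_gt0.
have [df _] := Cf.
have dsqrt x : U x -> differentiable (@Num.sqrt R) (f x) /\
    'd (@Num.sqrt R) (f x) = (fun h => h * (2 * Num.sqrt (f x))^-1) :> (R -> R).
  move=> Ux; have /derivable1_diffP dS : derivable (@Num.sqrt R) (f x) 1.
    by have [] := is_derive1_sqrt (f_gt0 _ Ux).
  split; first exact: dS.
  rewrite deriv1E; last exact/derivable1_diffP.
  by apply/funext => h; rewrite derive1E derive_sqrt// f_gt0.
apply: (CkV_of_halfderiv Cf s0) => [x Ux|x v Ux].
  exact: differentiable_comp (df x Ux) (dsqrt x Ux).1.
have H := diff_comp (df x Ux) (dsqrt x Ux).1.
by rewrite [LHS](congr1 (@^~ v) H) /= (dsqrt x Ux).2.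
Qed.

Lemma Ck_rational_closed k : rational_closed U (@Ck R k V R U).
Proof.
split; [exact: Ck_cst|exact: CkD|exact: CkM|exact: CkV].
Qed.

Lemma Ck_sum (W : normedModType R) k I (r : seq I) (F : I -> V -> W) :
  (forall i, Ck k U (F i)) -> Ck k U (fun x => \sum_(i <- r) F i x).
Proof.
move=> CF; elim: r => [|i r IHr].
  by under eq_fun do rewrite big_nil; exact: Ck_cst.
by under eq_fun do rewrite big_cons; exact: CkD.
Qed.

Lemma Ck_mx m p k (F : V -> 'M[R]_(m, p)) :
  (forall i j, Ck k U (fun x => F x i j)) -> Ck k U F.
Proof.
move=> CF; have -> : F = fun x => \sum_i \sum_j F x i j *: delta_mx i j.
  by apply/funext => x; exact: matrix_sum_delta.
by apply: Ck_sum => i; apply: Ck_sum => j; exact: CkZl.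
Qed.

End Generic.

Lemma diff_coord m p (X v : 'M[R]_(m, p)) i j :
  'd (fun Y : 'M[R]_(m, p) => Y i j : R) X v = v i j.
Proof.
have @f : {linear 'M[R]_(m, p) -> R}.
  by exists (fun N : 'M[R]_(_, _) => N i j); do 2![eexists]; do ?[constructor];
     rewrite ?mxE// => ? *; rewrite ?mxE//; move=> ?; rewrite !mxE.
rewrite (_ : (fun _ => _) = f)// diff_lin//.
exact: coord_continuous.
Qed.

Lemma Ck_coord m p k (U : set 'M[R]_(m, p)) i j :
  Ck k U (fun Y : 'M[R]_(m, p) => Y i j : R).
Proof.
case: k => [|k]; first by move=> X _; exact: coord_continuous.
split=> [X _|v]; first exact: differentiable_coord.
by under eq_fun do rewrite diff_coord; exact: Ck_cst.
Qed.

End CkCalculus.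

(** * Open domains and smoothness of the chart and of its inverse *)

Section Regularity.
Variables (R : realType) (n : nat).
Implicit Types (lam : 'rV[R]_n) (L Q X W : 'M[R]_n).

Lemma continuous_rational_closed (T : topologicalType) (x0 : T) :
  rational_closed [set x0] (fun f : T -> R => {for x0, continuous f}).
Proof.
split=> [c|f g|f g|f Cf f0]; first exact: cst_continuous.
- exact: continuousD.
- exact: continuousM.
- by apply: continuousV => //; exact: f0.
Qed.

Lemma continuous_mx (T : topologicalType) m p (F : T -> 'M[R]_(m, p)) x :
  (forall i j, {for x, continuous (fun y => F y i j)}) -> {for x, continuous F}.
Proof.
move=> CF; apply/cvgrPdist_le => /= e e0; near=> y.
rewrite /Num.Def.normr/= mx_normrE (bigmax_le _ (ltW e0))//= => i _.
rewrite !mxE/=; move: i; near: y; apply: filter_forall => /= i.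
exact: ((cvgrPdist_le _ _).1 (CF i.1 i.2)).
Unshelve. all: by end_near. Qed.

(** The pivots are rational in the entries with earlier pivots as denominators, hence continuous
    where all are positive, and there are finitely many. *)
Lemma open_gs_pos (T : topologicalType) (A : T -> 'I_n -> 'M[R]_n) :
  (forall i a b x, {for x, continuous (fun x => A x i a b)}) ->
  open [set x | gs_pos (A x)].
Proof.
move=> CA; rewrite openE => x /= Ax.
have H k : {for x, continuous (fun x => gs_pivot (A x) k)}.
  apply: (rclosed_pivot (continuous_rational_closed x)) => [i a b|_ -> l].
    exact: CA.
  by rewrite gt_eqF.
rewrite /interior/=; near=> y => k; move: k; near: y; apply: filter_forall => k.
have /cvgrPdist_lt/(_ _ (Ax k)) := H k; apply: filterS => y.
rewrite ltr_distlC => /andP[]; rewrite subrr.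
Unshelve. all: by end_near. Qed.

Lemma eigenproj_in (T : Type) (S : set T) (C : (T -> R) -> Prop)
    (F : T -> 'M[R]_n) lam i : rational_closed S C -> entries_in C F ->
  entries_in C (fun x => eigenproj lam (F x) i).
Proof.
move=> C_rat CF; rewrite /eigenproj; elim: [seq _ <- _ | _] => [|k s IHs] /=.
  exact: (entries_in_cst C_rat).
apply: (entries_inZ C_rat); first exact: (rclosed_cst C_rat).
apply: (entries_inM C_rat) => //; apply: (entries_inB C_rat) => //.
exact: (entries_in_cst C_rat).
Qed.

Definition chart_dom lam : set 'M[R]_n := [set X | gs_pos (eigenproj lam X)].

Lemma open_chart_dom lam : open (chart_dom lam).
Proof.
apply: open_gs_pos => i a b X.
apply: (eigenproj_in _ _ (continuous_rational_closed X)) => c d.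
exact: coord_continuous.
Qed.

Lemma smooth_chart lam k : Ck k (chart_dom lam) (chart lam).
Proof.
have oU := @open_chart_dom lam; have C_rat := Ck_rational_closed oU k.
have CX : entries_in (Ck k (chart_dom lam)) (fun X => X).
  by move=> i j; exact: Ck_coord.
have CA i := eigenproj_in lam i C_rat CX.
have CW :
    entries_in (Ck k (chart_dom lam)) (fun X => gs_normal (eigenproj lam X)).
  apply: (entries_in_gs_normal C_rat) => //.
  - by move=> X UX l; rewrite gt_eqF//; exact: UX.
  - by move=> f; exact: Ck_invsqrt.
apply: Ck_mx => // i j; under eq_fun do rewrite mxE.
exact: (entries_in_congr C_rat).
Qed.

(** An open set of matrices around L^Lambda, on which the formula of the inverse chart is its own
    smooth extension. *)
Definition gram_dom : set 'M[R]_n := [set L | gs_pos (fun=> L^T *m L)].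

Lemma open_gram_dom : open gram_dom.
Proof.
apply: open_gs_pos => _ a b X.
have C_rat := continuous_rational_closed X.
apply: (entries_inM C_rat); last by move=> c d; exact: coord_continuous.
apply: entries_in_tr => c d; exact: coord_continuous.
Qed.

Lemma smooth_gs_gram k :
  entries_in (Ck k gram_dom) (fun L => gs_normal (fun=> L^T *m L)).
Proof.
have C_rat := Ck_rational_closed (@open_gram_dom) k.
have CX : entries_in (Ck k gram_dom) (fun X => X).
  by move=> i j; exact: Ck_coord.
apply: (entries_in_gs_normal C_rat).
- by move=> _; apply: (entries_inM C_rat) => //; exact: entries_in_tr.
- by move=> X UX l; rewrite gt_eqF//; exact: UX.
- by move=> f; apply: Ck_invsqrt; exact: open_gram_dom.
- by [].
Qed.

Lemma smooth_chart_inv lam k : Ck k gram_dom (chart_inv lam).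
Proof.
have C_rat := Ck_rational_closed (@open_gram_dom) k.
have CX : entries_in (Ck k gram_dom) (fun X => X).
  by move=> i j; exact: Ck_coord.
have CQ : entries_in (Ck k gram_dom) (@orth_factor R n).
  by apply: (entries_inM C_rat) => //; exact: smooth_gs_gram.
apply: Ck_mx; first exact: open_gram_dom.
by apply: (entries_in_congr C_rat) => //; exact: (entries_in_cst C_rat).
Qed.

End Regularity.

(** * Density of the chart domains *)

Section Density.
Variable R : realType.

(* Rational functions regular at [0]; the values at the poles are irrelevant. *)
Definition germ_rational (f : R -> R) : Prop :=
  exists p q : {poly R},
    q.[0] != 0 /\ forall t, q.[t] != 0 -> f t = p.[t] / q.[t].

Lemma germ_rational_closed : rational_closed [set 0] germ_rational.
Proof.
split=> [c|f g [p [q [q0 fE]]] [p' [q' [q0' gE]]]|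
  f g [p [q [q0 fE]]] [p' [q' [q0' gE]]]|f].
- exists c%:P, 1; rewrite hornerC oner_eq0; split=> // t _.
  by rewrite !hornerC divr1.
- exists (p * q' + p' * q), (q * q'); rewrite hornerM mulf_neq0//; split=> // t.
  rewrite !hornerE mulf_eq0 negb_or => /andP[qt qt'].
  by rewrite fE// gE// addf_div.
- exists (p * p'), (q * q'); rewrite hornerM mulf_neq0//; split=> // t.
  rewrite !hornerE mulf_eq0 negb_or => /andP[qt qt'].
  by rewrite fE// gE// mulf_div.
move=> [p [q [q0 fE]]] /(_ 0 erefl).
rewrite fE// mulf_eq0 negb_or => /andP[p0 _].
(* The fraction [q / p] is expanded by [q] so that the new denominator also excludes the zeros of
   [q], where [f] is unknown. *)
exists (q ^+ 2), (p * q); rewrite hornerM mulf_neq0//; split=> // t.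
rewrite !hornerE mulf_eq0 negb_or => /andP[pt qt].
by rewrite fE// invf_div expr2 -mulf_div divff// mulr1.
Qed.

Lemma germ_rational_id : germ_rational id.
Proof.
exists 'X, 1; rewrite hornerC oner_eq0; split=> // t _.
by rewrite hornerX hornerC divr1.
Qed.

Lemma poly_nonroot_near (p : {poly R}) (x : R) (B : set R) :
  p != 0 -> nbhs x B -> exists2 t, B t & p.[t] != 0.
Proof.
move=> p0 /nbhs_ballP[e /= e0 eB].
(* These are infinitely many distinct points of the ball, and a nonzero [p] cannot vanish at
   [size p] of them. Starting the denominators at 2 keeps the first point strictly inside. *)
have e_small k : B (x + e / k.+2%:R).
  apply: eB; rewrite /ball/= opprD addNKr normrN ger0_norm ?divr_ge0 ?ltW//.
  by rewrite ltr_pdivrMr// ltr_pMr// ltr1n.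
pose s := [seq x + e / k.+2%:R | k <- iota 0 (size p)].
have s_uniq : uniq s.
  rewrite map_inj_uniq ?iota_uniq// => j k /addrI /(mulfI (lt0r_neq0 e0)).
  by move=> /invr_inj /eqP; rewrite eqr_nat => /eqP[].
have := contraNN (fun H => max_poly_roots p0 H s_uniq).
rewrite size_map size_iota ltnn => /(_ isT)/allPn[_ /mapP[k _ ->] pk].
by exists (x + e / k.+2%:R).
Qed.

(** Nonvanishing at 0 makes numerator and denominator nonzero polynomials, which then have common
    nonroots near every point [x]. *)
Lemma germ_rational_nonzero_near (f : R -> R) (x : R) (B : set R) :
  germ_rational f -> f 0 != 0 -> nbhs x B -> exists2 t, B t & f t != 0.
Proof.
move=> [p [q [q0 fE]]]; rewrite fE// mulf_eq0 negb_or => /andP[p0 _] Bx.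
have [|t Bt] := @poly_nonroot_near (p * q) _ _ _ Bx.
  by apply: mulf_neq0; [apply: contraNneq p0 => ->|apply: contraNneq q0 => ->];
    rewrite horner0.
rewrite hornerM mulf_eq0 negb_or => /andP[pt qt].
by exists t => //; rewrite fE// mulf_neq0// invr_neq0.
Qed.

Lemma det_neg1_dim m (Q : 'M[R]_m) : \det Q = -1 -> (0 < m)%N.
Proof.
by case: m Q => // Q; rewrite det_mx00 => H; exfalso; lra.
Qed.

Variable n : nat.
Implicit Types (lam d : 'rV[R]_n) (Q X W : 'M[R]_n).

(* The signs are chosen row by row: by multilinearity the determinants obtained
   for the two signs differ by a nonzero multiple of the previous one. *)
Lemma sign_shift_unit Q : exists d : 'rV[R]_n,
  (forall i, d 0 i ^+ 2 = 1) /\ \det (diag_mx d + Q) != 0.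
Proof.
pose M (d : 'rV[R]_n) m : 'M[R]_n := \matrix_(i, j)
  (d 0 i *+ (i == j) + if (i < m)%N then Q i j else 0).
have : forall m, (m <= n)%N -> exists d : 'rV[R]_n,
    (forall i, d 0 i ^+ 2 = 1) /\ \det (M d m) != 0.
  elim=> [_|m IHm mn].
    exists (const_mx 1); split=> [i|]; first by rewrite mxE expr1n.
    rewrite (_ : M _ _ = 1%:M) ?det1 ?oner_eq0//.
    by apply/matrixP => i j; rewrite !mxE addr0.
  have [d [d1 dM]] := IHm (ltnW mn); pose l := Ordinal mn.
  pose d' s : 'rV[R]_n := \row_i (if i == l then s else d 0 i).
  have d'1 s : s ^+ 2 = 1 -> forall i, d' s 0 i ^+ 2 = 1.
    by move=> s1 i; rewrite mxE; case: ifP.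
  have detM s : \det (M (d' s) m.+1) =
      s * d 0 l * \det (M d m) + 1 * \det (M (d' 0) m.+1).
    apply: (@determinant_multilinear _ _ _ _ _ l).
    - apply/rowP => j; rewrite !mxE !eqxx ltnSn ltnn addr0 mul0rn add0r mul1r.
      by rewrite mulrnAr -mulrA -expr2 d1 mulr1.
    - apply/matrixP => i j; rewrite !mxE.
      have il : (lift l i == l) = false.
        by rewrite eq_sym (negPf (neq_lift l i)).
      rewrite il; congr (_ + _).
      have iml : (nat_of_ord (lift l i) == m) = false by rewrite -il -val_eqE.
      by rewrite [in RHS]ltnS [in RHS]leq_eqVlt iml.
    - apply/matrixP => i j; rewrite !mxE.
      by rewrite (_ : (lift l i == l) = false)// eq_sym (negPf (neq_lift l i)).
  have dl0 : d 0 l != 0.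
    by have := oner_neq0 R; rewrite -(d1 l) sqrf_eq0.
  have [E1|] := eqVneq (\det (M (d' 1) m.+1)) 0; last first.
    by exists (d' 1); split=> //; apply: d'1; rewrite expr1n.
  exists (d' (-1)); split; first by apply: d'1; rewrite sqrrN expr1n.
  apply/eqP => E2; have := detM 1; have := detM (-1); rewrite E1 E2.
  move: (\det (M d m)) dM (\det (M (d' 0) m.+1)) => a dM b F1 F2.
  have : d 0 l * a * 2 = 0 by lra.
  by apply/eqP; rewrite !mulf_neq0// pnatr_eq0.
move=> /(_ n (leqnn n))[d [d1 dM]]; exists d; split=> //.
rewrite (_ : _ + _ = M d n)//; apply/matrixP => i j.
by rewrite !mxE ltn_ord.
Qed.

(** If [Q] has determinant -1, changing the sign of its first row repairs this without changing the
    conjugate, since the sign matrix commutes with [diag_mx lam]. *)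
Lemma orth_class_orth X0 lam Q : orth_class X0 (diag_mx lam) ->
  Q^T *m Q = 1%:M -> orth_class X0 (Q^T *m diag_mx lam *m Q).
Proof.
move=> lamX QQ; have /eqP := congr1 determinant QQ.
rewrite det_mulmx det_tr det1 -expr2 sqrf_eq1 => /orP[/eqP dQ|/eqP dQ].
  exact: orth_classP.
pose i0 := Ordinal (det_neg1_dim dQ).
pose D : 'M[R]_n := diag_mx (\row_i (if i == i0 then -1 else 1)).
have DD lam' : D *m diag_mx lam' *m D = diag_mx lam'.
  rewrite !mulmx_diag; congr diag_mx; apply/rowP => i; rewrite !mxE mulrAC.
  by case: ifP; rewrite ?mulrNN !mul1r.
have DTD : D^T *m D = 1%:M.
  by rewrite tr_diag_mx -[D in D *m _]mulmx1 -diag_const_mx DD.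
have dD : \det D = -1.
  rewrite det_diag (bigD1 i0)//= big1 ?mulr1 => [|i /negPf ii].
    by rewrite mxE eqxx.
  by rewrite mxE ii.
have -> : Q^T *m diag_mx lam *m Q = (D *m Q)^T *m diag_mx lam *m (D *m Q).
  rewrite trmx_mul tr_diag_mx -[in LHS]DD.
  by rewrite !mulmxA.
apply: orth_classP => //; split; last by rewrite det_mulmx dD dQ mulrNN mulr1.
by rewrite trmx_mul -mulmxA (mulmxA D^T) DTD mul1mx.
Qed.

Lemma gs_pos_eigenblock lam : gs_pos (eigenblock lam).
Proof.
have [|//] := @gs_normal_uniq _ _ (eigenblock lam) 1%:M.
split=> [i j ji|i|k j _]; first by rewrite mxE -val_eqE/= gtn_eqF.
  by rewrite mxE eqxx ltr01.
rewrite trmx1 mul1mx mulmx1 !mxE; case: (k =P j) => _; last by rewrite mulr0n.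
by rewrite eqxx.
Qed.

(** The pivot is a squared norm because the eigenblock is a symmetric idempotent; positivity thus
    reduces to nonvanishing. *)
Lemma eigenblock_congr_pivot lam Q k :
  0 <= gs_pivot (fun i => Q^T *m eigenblock lam i *m Q) k.
Proof.
rewrite /gs_pivot; set V := gs _ _; set E := eigenblock lam k.
have -> : V^T *m (Q^T *m E *m Q) *m V = (E *m Q *m V)^T *m (E *m Q *m V).
  rewrite !trmx_mul tr_diag_mx -/E !mulmxA -(mulmxA _ E E).
  by rewrite eigenblock_mul eqxx.
by rewrite mxE; apply: sumr_ge0 => i _; rewrite mxE -expr2 sqr_ge0.
Qed.

(** * The Cayley path from the identity to an orthogonal matrix *)

Section CayleyPath.
Variables (Q : 'M[R]_n).
Hypothesis QQ : Q^T *m Q = 1%:M.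
Hypothesis Q_unit : \det (1%:M + Q) != 0.

Let N t : 'M[R]_n := (1%:M + Q) + t *: (1%:M - Q).

(** The quotient of [N (- t)] by [N t], with the inverse written by Cramer's formula so that its
    entries are visibly rational in [t]. *)
Definition cayley_path t : 'M[R]_n :=
  N (- t) *m ((\det (N t))^-1 *: \adj (N t)).

Let cayley_invE t : \det (N t) != 0 ->
  (\det (N t))^-1 *: \adj (N t) = invmx (N t).
Proof. by move=> Nt; rewrite /invmx unitmxE unitfE Nt. Qed.

Let N0 : N 0 = 1%:M + Q. Proof. by rewrite /N scale0r addr0. Qed.

Let N1 : N 1 = 2%:M.
Proof.
rewrite /N scale1r addrACA subrr addr0; apply/matrixP => i j.
by rewrite !mxE -mulrnDl.
Qed.

Let detN1 : \det (N 1) != 0.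
Proof. by rewrite N1 det_scalar expf_neq0// pnatr_eq0. Qed.

Lemma cayley_path0 : cayley_path 0 = 1%:M.
Proof.
by rewrite /cayley_path cayley_invE ?N0// oppr0 N0 mulmxV// unitmxE unitfE.
Qed.

Lemma cayley_path1 : cayley_path 1 = Q.
Proof.
rewrite /cayley_path cayley_invE// N1 invmx_scalar.
have -> : N (- 1) = Q *+ 2.
  by apply/matrixP => i j; rewrite /N mulr2n !mxE; ring.
rewrite mul_mx_scalar mulr2n scalerDr -scalerDl.
by rewrite (_ : 2^-1 + 2^-1 = 1) ?scale1r//; field.
Qed.

(** Orthogonality of [Q] cancels the cross terms in [(N s)^T *m N s], which is therefore even in
    [s]. *)
Lemma cayley_path_orth t : \det (N t) != 0 ->
  (cayley_path t)^T *m cayley_path t = 1%:M.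
Proof.
move=> Nt; have uN : N t \in unitmx by rewrite unitmxE unitfE.
rewrite /cayley_path cayley_invE// trmx_mul -mulmxA (mulmxA (N (- t))^T).
have -> : (N (- t))^T *m N (- t) = (N t)^T *m N t.
  have NE s : (N s)^T *m N s =
      (1%:M + Q)^T *m (1%:M + Q) + s ^+ 2 *: ((1%:M - Q)^T *m (1%:M - Q)).
    have cross : (1%:M + Q)^T *m (1%:M - Q) + (1%:M - Q)^T *m (1%:M + Q) = 0.
      have -> : (1%:M + Q)^T = 1%:M + Q^T by rewrite linearD/= trmx1.
      have -> : (1%:M - Q)^T = 1%:M - Q^T by rewrite linearB/= trmx1.
      rewrite !mulmxDl !mulmxDr !mulNmx !mulmxN QQ !mul1mx !mulmx1.
      by apply/matrixP => i j; rewrite !mxE; ring.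
    rewrite /N; move: (1%:M + Q) (1%:M - Q) cross => A B cross.
    have -> : (A + s *: B)^T = A^T + s *: B^T.
      by apply/matrixP => i j; rewrite !mxE.
    rewrite mulmxDl !mulmxDr -!scalemxAl -!scalemxAr scalerA -expr2.
    rewrite -[LHS]addrA; congr (_ + _).
    by rewrite addrA -scalerDr cross scaler0 add0r.
  by rewrite !NE sqrrN.
by rewrite -mulmxA mulmxV// mulmx1 trmx_inv mulVmx// unitmx_tr.
Qed.

Lemma cayley_path_in (S : set R) C : rational_closed S C -> C id ->
    (forall t, S t -> \det (N t) != 0) -> entries_in C cayley_path.
Proof.
move=> C_rat Cid NS.
have CN s : entries_in C (fun t => N (s * t)).
  apply: (entries_inD C_rat); first exact: (entries_in_cst C_rat).
  apply: (entries_inZ C_rat); last exact: (entries_in_cst C_rat).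
  by apply: (rclosedM C_rat) => //; exact: (rclosed_cst C_rat).
apply: (entries_inM C_rat).
  by have := CN (-1); under eq_fun do rewrite mulN1r.
apply: (entries_in_inv C_rat) => //.
by have := CN 1; under eq_fun do rewrite mul1r.
Qed.

Lemma dense_at_cayley lam (B : set 'M[R]_n) :
    nbhs (Q^T *m diag_mx lam *m Q) B ->
  exists2 P, P^T *m P = 1%:M & let Y := P^T *m diag_mx lam *m P in
    B Y /\ gs_pos (eigenproj lam Y).
Proof.
pose Y t := (cayley_path t)^T *m diag_mx lam *m cayley_path t.
pose A t i := (cayley_path t)^T *m eigenblock lam i *m cayley_path t.
have C1 := @continuous_rational_closed R R 1.
have Cpath : entries_in (fun f : R -> R => {for 1, continuous f}) cayley_path.
  by apply: (cayley_path_in C1) => [|_ ->] //; exact: cvg_id.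
have contY : {for 1, continuous Y}.
  apply: continuous_mx; apply: (entries_in_congr C1) => //.
  exact: (entries_in_cst C1).
have <- : Y 1 = Q^T *m diag_mx lam *m Q by rewrite /Y cayley_path1.
move=> /contY BY.
have C0 := germ_rational_closed.
have N0' t : [set 0] t -> \det (N t) != 0 by move=> ->; rewrite N0.
have Gpath := cayley_path_in C0 germ_rational_id N0'.
have GA i : entries_in germ_rational (fun t => A t i).
  by apply: (entries_in_congr C0) => //; exact: (entries_in_cst C0).
have A0 : A 0 = eigenblock lam.
  by apply/funext => i; rewrite /A cayley_path0 trmx1 mul1mx mulmx1.
have Apiv t : [set 0] t -> forall k, gs_pivot (A t) k != 0.
  by move=> -> k; rewrite A0 gt_eqF//; exact: gs_pos_eigenblock.
have Gpiv := rclosed_pivot C0 GA Apiv.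
have GN : germ_rational (fun t => \det (N t)).
  apply: (rclosed_det C0); apply: (entries_inD C0).
    exact: (entries_in_cst C0).
  apply: (entries_inZ C0); last exact: (entries_in_cst C0).
  exact: germ_rational_id.
(* A single function whose nonvanishing at [t] yields both the invertibility of [N t] and the
   nonvanishing of all the pivots. *)
have GF := rclosedM C0 GN (rclosed_prod C0 (index_enum 'I_n) xpredT Gpiv).
have [|t Bt] := germ_rational_nonzero_near GF _ BY.
  by rewrite mulf_neq0// ?N0//; apply/prodf_neq0 => k _; exact: Apiv.
rewrite mulf_eq0 negb_or => /andP[Nt /prodf_neq0 pivt].
have Pt := cayley_path_orth Nt; exists (cayley_path t) => //; split=> // k.
have -> : eigenproj lam (Y t) = A t.
  by apply/funext => i; exact: eigenproj_conj.
by rewrite lt_neqAle eq_sym pivt//=; exact: eigenblock_congr_pivot.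
Qed.

End CayleyPath.

Lemma orth_class_conj X0 X lam :
    orth_class X0 (diag_mx lam) -> orth_class X0 X ->
  exists2 Q, Q^T *m Q = 1%:M & X = Q^T *m diag_mx lam *m Q.
Proof.
move=> [Q1 [QQ1 _] E1] [Q2 [QQ2 _] E2].
exists (Q1^T *m Q2).
  by rewrite trmx_mul trmxK -mulmxA (mulmxA Q1) (mulmx1C QQ1) mul1mx.
rewrite -E1 -E2 trmx_mul trmxK !mulmxA -(mulmxA _ Q1) (mulmx1C QQ1) mulmx1.
by rewrite -(mulmxA _ Q1) (mulmx1C QQ1) mulmx1.
Qed.

Lemma chart_dom_dense X0 lam : orth_class X0 (diag_mx lam) ->
  orth_class X0 `<=` closure (chart_dom lam `&` orth_class X0).
Proof.
move=> lamX X XX0 B BX.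
have [Q QQ XE] := orth_class_conj lamX XX0.
have [d [d1 dQ]] := sign_shift_unit Q.
have dd : diag_mx d *m diag_mx d = 1%:M.
  rewrite mulmx_diag -diag_const_mx; congr diag_mx.
  by apply/rowP => i; rewrite !mxE -expr2 d1.
(* The signs commute with [diag_mx lam], so [Q'] represents the same [X], and [1 + Q'] is
   [diag_mx d] times the invertible [diag_mx d + Q]. *)
pose Q' := diag_mx d *m Q.
have QQ' : Q'^T *m Q' = 1%:M.
  by rewrite trmx_mul tr_diag_mx -mulmxA (mulmxA (diag_mx d)) dd mul1mx.
have dQ' : \det (1%:M + Q') != 0.
  have -> : 1%:M + Q' = diag_mx d *m (diag_mx d + Q) by rewrite mulmxDr dd.
  rewrite det_mulmx mulf_neq0// det_diag; apply/prodf_neq0 => i _.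
  by have := oner_neq0 R; rewrite -(d1 i) sqrf_eq0.
have XE' : X = Q'^T *m diag_mx lam *m Q'.
  rewrite XE trmx_mul tr_diag_mx !mulmxA.
  rewrite -(mulmxA Q^T (diag_mx d) (diag_mx lam)).
  by rewrite diag_mxC !mulmxA -(mulmxA _ (diag_mx d) (diag_mx d)) dd mulmx1.
rewrite XE' in BX; have [P PP [BP posP]] := dense_at_cayley QQ' dQ' BX.
exists (P^T *m diag_mx lam *m P); split=> //; split=> //.
exact: orth_class_orth.
Qed.

End Density.

(** * The Toda field in the chart *)

Section MatrixDerivative.
Variables (R : realType) (V : normedModType R).
Implicit Types (x v : V).

Lemma derive_entry m p (F : V -> 'M[R]_(m, p)) x v i j : derivable F x v ->
  ('D_v F x) i j = 'D_v (fun y => F y i j) x.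
Proof. by move=> dF; rewrite derive_mx// mxE. Qed.

Lemma derivable_mulmx m p q
    (F : V -> 'M[R]_(m, p)) (G : V -> 'M[R]_(p, q)) x v :
    derivable F x v -> derivable G x v ->
  derivable (fun y => F y *m G y) x v /\
  'D_v (fun y => F y *m G y) x = 'D_v F x *m G x + F x *m 'D_v G x.
Proof.
move=> dF dG; have dFi := (derivable_mxP _ _ _).1 dF.
have dGi := (derivable_mxP _ _ _).1 dG.
have sumE i j : (fun y => (F y *m G y) i j) =
    \sum_(k < p) ((fun y => F y i k) * (fun y => G y k j)).
  by apply/funext => y; rewrite mxE fct_sumE.
have dFG : derivable (fun y => F y *m G y) x v.
  apply/derivable_mxP => i j; rewrite sumE; apply: derivable_sum => k.
  exact: derivableM.
split=> //; apply/matrixP => i j; rewrite derive_entry// sumE derive_sum.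
  rewrite !mxE -big_split/=; apply: eq_bigr => k _.
  rewrite deriveM// (derive_entry _ _ dF) (derive_entry _ _ dG) addrC.
  by congr (_ + _); exact: mulrC.
by move=> k; exact: derivableM.
Qed.

Lemma derivable_trmx m p (F : V -> 'M[R]_(m, p)) x v : derivable F x v ->
  derivable (fun y => (F y)^T) x v /\ 'D_v (fun y => (F y)^T) x = ('D_v F x)^T.
Proof.
move=> dF; have dFi := (derivable_mxP _ _ _).1 dF.
have trE i j : (fun y => (F y)^T i j) = (fun y => F y j i).
  by apply/funext => y; rewrite mxE.
have dFT : derivable (fun y => (F y)^T) x v.
  by apply/derivable_mxP => i j; rewrite trE.
split=> //; apply/matrixP => i j.
by rewrite derive_entry// trE mxE derive_entry.
Qed.

End MatrixDerivative.

Section TodaChart.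
Variables (R : realType) (n : nat).
Implicit Types (lam : 'rV[R]_n) (L Q X W : 'M[R]_n).

Let linear_field lam L := lie_bracket L (- diag_mx lam).

Lemma linear_fieldE lam L i j :
  lie_bracket L (- diag_mx lam) i j = (lam ord0 i - lam ord0 j) * L i j.
Proof.
rewrite /lie_bracket mulmxN mulNmx opprK addrC mul_mx_diag mul_diag_mx !mxE.
by rewrite mulrBl (mulrC (L i j)).
Qed.

Lemma chart_inv_toda lam L : \tr (diag_mx lam) = 0 -> unit_lower L ->
  'D_(linear_field lam L) (chart_inv lam) L = toda (chart_inv lam L).
Proof.
move=> tr_lam lL; have [_ uL] := unit_lower_unitmx lL.
have posL := gs_pos_gram uL; have UL : gram_dom L by exact: posL.
have oU := @open_gram_dom R n.
set xi := linear_field lam L.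
pose W L' := gs_normal (fun=> L'^T *m L').
have diffW : differentiable W L.
  by case: (Ck_mx oU (@smooth_gs_gram R n 1)) => + _; apply.
have dW : derivable W L xi by exact: diff_derivable.
have dI := @derivable_id _ _ L xi.
have [dQ DQ] := derivable_mulmx dI dW.
have dQT := derivable_trmx dQ.
set Q := fun L' => L' *m W L' in dQ DQ dQT.
set Q' := 'D_xi Q L in DQ dQT.
have QE : Q = @orth_factor R n by [].
have dLam := @derivable_cst _ _ _ (diag_mx lam) L xi.
have [dX1 DX1] := derivable_mulmx dQT.1 dLam.
have [dX DX] := derivable_mulmx dX1 dQ.
have [_ DI] := derivable_mulmx dQT.1 dQ.
have QQ : (Q L)^T *m Q L = 1%:M by exact: orth_factorP.
have QQ' := mulmx1C QQ.
pose X := chart_inv lam L; pose S := (Q L)^T *m Q'.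
have XE : X = (Q L)^T *m diag_mx lam *m Q L by [].
(* Differentiate [Q^T *m Q = 1], which holds on a whole neighborhood of [L] since [gram_dom] is
   open. *)
have S_skew : S^T = - S.
  have : 'D_xi (fun y => (Q y)^T *m Q y) L = 0.
    rewrite -(derive_cst (1%:M : 'M[R]_n) L xi); apply: near_eq_derive.
    have : nbhs L (@gram_dom R n) by apply: open_nbhs_nbhs.
    by apply: filterS => y; exact: orth_factorP.
  rewrite DI dQT.2 -/Q' -/S => /eqP; rewrite addr_eq0 => /eqP.
  by rewrite /S (trmx_mul (Q L)^T) trmxK.
have Q'E : Q' = Q L *m S by rewrite /S mulmxA QQ' mul1mx.
have uW : W L \in unitmx.
  by have [_] := mulmx1_unit QQ; rewrite unitmx_mul => /andP[].
have QL : (Q L)^T *m L = invmx (W L).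
  by apply: (can_inj (mulmxK uW)); rewrite -mulmxA mulVmx.
have upW : upper_mx (W L) /\ forall i, 0 < W L i i.
  by have [] := gs_normalP posL.
have upV := (triangular_frame_inv upW.1 upW.2).1.
(* The entries of [W] below the diagonal vanish identically, for every argument. *)
have upW' : upper_mx ('D_xi W L).
  move=> i j ji; rewrite (derive_entry _ _ dW).
  rewrite (_ : (fun y => W y i j) = cst 0) ?derive_cst//; apply/funext => y.
  have [uG _] := (unit_upperP _).1 (unit_upper_gs (fun=> y^T *m y) n).
  by rewrite /W mxE uG// mul0r.
(* Multiply the derivative of [Q = L W] by [Q^T] and use [Q^T L = W^-1]: the part [Lambda L] of the
   field gives [X], and all other terms are upper triangular. *)
have XS : X - S = invmx (W L) *m diag_mx lam *m W L - invmx (W L) *m 'D_xi W L.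
  rewrite /S DQ derive_id mulmxDr (mulmxA _ L) QL mulmxA.
  rewrite /xi /linear_field /lie_bracket mulmxN mulNmx opprK mulmxDr mulmxN.
  rewrite mulmxDl mulNmx !mulmxA QL -(mulmxA _ L) XE mulmxA.
  by rewrite opprD opprD opprK addrA addrCA subrr addr0.
have trS : \tr S = 0.
  have /eqP := mxtrace_tr S; rewrite S_skew linearN/= eq_sym -subr_eq0 opprK.
  by rewrite -mulr2n mulrn_eq0 => /eqP.
have trX : \tr X = 0.
  by rewrite XE mxtrace_mulC mulmxA QQ' mul1mx.
have SE : pi_so X = S.
  apply: pi_so_uniq; first exact: S_skew.
  split; first by rewrite linearB/= trX trS subr0.
  have up_lam : upper_mx (diag_mx lam).
    by move=> i j ji; rewrite mxE -val_eqE/= gtn_eqF.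
  move=> i j ji; rewrite XS !mxE.
  have := upper_mxM (upper_mxM upV up_lam) upW.1 ji; rewrite mxE => ->.
  by have := upper_mxM upV upW' ji; rewrite mxE => ->; rewrite subr0.
rewrite /toda -/X SE /lie_bracket.
rewrite [LHS]DX DX1 derive_cst mulmx0 addr0 dQT.2 -/Q' Q'E.
by rewrite (trmx_mul (Q L)) S_skew !mulNmx XE !mulmxA addrC.
Qed.

Lemma chartK lam Q X : Q^T *m Q = 1%:M -> X = Q^T *m diag_mx lam *m Q ->
    chart_dom lam X ->
  unit_lower_at lam (chart lam X) /\ chart_inv lam (chart lam X) = X.
Proof.
move=> QQ XE domX; have QQ' := mulmx1C QQ.
have E i : eigenproj lam X i = Q^T *m eigenblock lam i *m Q.
  by rewrite XE eigenproj_conj.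
have mulE i j : eigenproj lam X i *m eigenproj lam X j =
    Q^T *m (eigenblock lam i *m eigenblock lam j) *m Q.
  by rewrite !E !mulmxA -(mulmxA _ Q) QQ' mulmx1.
apply: eigenframe => //.
- by move=> i; rewrite E !trmx_mul trmxK tr_diag_mx mulmxA.
- move=> i j ij; rewrite !E; congr (_ *m diag_mx _ *m _).
  by apply/rowP => k; rewrite !mxE ij.
- by move=> i; rewrite mulE eigenblock_mul eqxx E.
- by move=> i j ij; rewrite mulE eigenblock_mul (negPf ij) mulmx0 mul0mx.
- move=> i; rewrite E XE !mulmxA -(mulmxA _ Q) QQ' mulmx1.
  rewrite scalemxAl scalemxAr -(mulmxA Q^T); congr (_ *m _ *m _).
  rewrite mulmx_diag -linearZ/=; congr diag_mx; apply/rowP => k; rewrite !mxE.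
  by case: eqP => [->|]; rewrite ?mulr1 ?mul1r// mulr0 mul0r.
Qed.

End TodaChart.

(** * The chart on the orthogonal class and the push-forward of the field *)

Section Pushforward.
Variables (R : realType) (n : nat) (X0 : 'M[R]_n).
Hypothesis X0_tr : \tr X0 = 0.
Implicit Types (lam : 'rV[R]_n) (L X Q : 'M[R]_n).

Lemma unit_lower_at_dom lam L : unit_lower_at lam L -> gram_dom L.
Proof. by move=> [lL _]; have [_ /gs_pos_gram] := unit_lower_unitmx lL. Qed.

Lemma chart_inv_in lam L : orth_class X0 (diag_mx lam) -> unit_lower_at lam L ->
  (chart_dom lam `&` orth_class X0) (chart_inv lam L).
Proof.
move=> lamX lL; split; first by have [] := chart_invK lL.
by apply: orth_classP => //; apply: orth_factor_SO; exact: lL.1.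
Qed.

Lemma chart_in lam X : orth_class X0 (diag_mx lam) ->
    (chart_dom lam `&` orth_class X0) X ->
  unit_lower_at lam (chart lam X) /\ chart_inv lam (chart lam X) = X.
Proof.
move=> lamX [domX XX0]; have [Q QQ XE] := orth_class_conj lamX XX0.
exact: chartK QQ XE domX.
Qed.

Lemma mxtrace_orth_class X : orth_class X0 X -> \tr X = 0.
Proof.
move=> [Q [QQ _] <-].
by rewrite mxtrace_mulC mulmxA (mulmx1C QQ) mul1mx.
Qed.

(* Any local extension of the chart, composed with the inverse chart, is the
   identity along the line [h |-> L + h [L, - Lambda]] of [L^Lambda]. *)
Lemma chart_pushes_forward lam : orth_class X0 (diag_mx lam) ->
  pushes_forward (chart_dom lam `&` orth_class X0) (chart lam) (@toda R n)
    (fun L => lie_bracket L (- diag_mx lam)).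
Proof.
move=> lamX X VX U F [oU UX CF FE]; have [lL XE] := chart_in lamX VX.
set L := chart lam X in lL XE *; set xi := lie_bracket L (- diag_mx lam).
have UL := unit_lower_at_dom lL.
have diffG : differentiable (chart_inv lam) L.
  by case: (@smooth_chart_inv R n lam 1) => + _; apply.
have diffF : differentiable F (chart_inv lam L).
  by rewrite XE; case: (CF 1%N) => + _; apply.
have toda_xi : toda X = 'd (chart_inv lam) L xi.
  rewrite -(deriveE xi diffG) -[in LHS]XE -chart_inv_toda//.
    exact: mxtrace_orth_class.
  exact: lL.1.
have diffFG := differentiable_comp diffG diffF.
have -> : 'd F X (toda X) = 'D_xi (F \o chart_inv lam) L.
  rewrite (deriveE xi diffFG) toda_xi -[in LHS]XE.
  exact: (esym (congr1 (@^~ xi) (diff_comp diffG diffF))).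
have LxiE h i j :
    (h *: xi + L) i j = (h * (lam ord0 i - lam ord0 j) + 1) * L i j.
  by rewrite mxE [(h *: xi) i j]mxE linear_fieldE; ring.
have lLxi h : unit_lower_at lam (h *: xi + L).
  case: lL => -[/is_trig_mxP trL L1] L0; split; first split.
  - by apply/is_trig_mxP => i j ij; rewrite LxiE trL// mulr0.
  - by move=> i; rewrite LxiE subrr mulr0 add0r mul1r L1.
  - by move=> i j e ij; rewrite LxiE L0// mulr0.
apply: cvg_lim => //.
have contL : chart_inv lam (h *: xi + L) @[h --> (0 : R)] --> chart_inv lam L.
  have cL : (h *: xi + L) @[h --> (0 : R)] --> (0 : R) *: xi + L.
    by apply: cvgD; [apply: cvgZr_tmp; exact: cvg_id|exact: cvg_cst].
  rewrite scale0r add0r in cL.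
  exact: cvg_comp cL (differentiable_continuous diffG).
have nearU : \forall h \near (0 : R), U (chart_inv lam (h *: xi + L)).
  by apply: contL; rewrite XE; exact: open_nbhs_nbhs.
have FGE h : U (chart_inv lam (h *: xi + L)) ->
    F (chart_inv lam (h *: xi + L)) = h *: xi + L.
  move=> Uh; rewrite FE//; last exact: chart_inv_in.
  by have [] := chart_invK (lLxi h).
apply: cvg_near_cst.
near=> h.
rewrite /= FGE; last by near: h; apply: nbhs_dnbhs.
have := FGE 0; rewrite scale0r add0r XE => ->//.
rewrite addrK scalerA mulVf ?scale1r//.
near: h; exact: nbhs_dnbhs_neq.
Unshelve. all: by end_near. Qed.

Lemma chart_diffeomorphism lam : orth_class X0 (diag_mx lam) ->
  diffeomorphism (chart_dom lam `&` orth_class X0) (unit_lower_at lam)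
    (chart lam).
Proof.
move=> lamX; have chartP X := @chart_in lam X lamX; split.
- split.
  + by move=> X /chartP[].
  + move=> X Y /set_mem/chartP[_ XE] /set_mem/chartP[_ YE] XY.
    by rewrite -XE XY YE.
  + move=> L lL; exists (chart_inv lam L); first exact: chart_inv_in.
    by have [] := chart_invK lL.
- move=> X [domX _]; exists (chart_dom lam), (chart lam); split=> //.
    exact: open_chart_dom.
  by move=> k; exact: smooth_chart.
exists (chart_inv lam) => [X /chartP[]//|L lL].
exists (@gram_dom R n), (chart_inv lam); split=> //.
- exact: open_gram_dom.
- exact: unit_lower_at_dom lL.
- by move=> k; exact: smooth_chart_inv.
Qed.

End Pushforward.

Unset Implicit Arguments.
Set Strict Implicit.
Set Printing Implicit Defensive.

Theorem theorem1 (R : realType) (n : nat) (X0 : 'M[R]_n)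
    (X0_sym : X0^T = X0) (X0_tr : \tr X0 = 0) :
  let O := orth_class X0 in
  let diagonals := [set lam : 'rV[R]_n | O (diag_mx lam)] in
  finite_set diagonals /\
  exists (V : 'rV[R]_n -> set 'M[R]_n)
         (phi : 'rV[R]_n -> 'M[R]_n -> 'M[R]_n),
    (forall lam : 'rV[R]_n, diagonals lam ->
      [/\ (exists2 U : set 'M[R]_n, open U & V lam = U `&` O),
          V lam (diag_mx lam),
          diffeomorphism (V lam) (unit_lower_at lam) (phi lam),
          pushes_forward (V lam) (phi lam) (@toda R n)
            (fun L => lie_bracket L (- diag_mx lam)) /\
          (forall L : 'M[R]_n, unit_lower_at lam L -> forall i j,
            lie_bracket L (- diag_mx lam) i j
              = (lam ord0 i - lam ord0 j) * L i j)
        & O `<=` closure (V lam)]) /\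
    \bigcup_(lam in diagonals) V lam = O.
Proof.
move=> O diagonals; split; first exact: finite_orth_class_diag.
exists (fun lam => chart_dom lam `&` O), (@chart R n); split.
  move=> lam lamX; split.
  - by exists (chart_dom lam) => //; exact: open_chart_dom.
  - split=> //; have EE : eigenproj lam (diag_mx lam) = eigenblock lam.
      apply/funext => i; have := @eigenproj_conj _ _ lam 1%:M i.
      rewrite trmx1 !mul1mx !mulmx1; exact.
    by rewrite /chart_dom/= EE; exact: gs_pos_eigenblock.
  - exact: chart_diffeomorphism.
  - by split=> [|L _ i j]; [exact: chart_pushes_forward|exact: linear_fieldE].
  - exact: chart_dom_dense.
apply/seteqP; split=> [X [lam _ []]//|X XX0].
have X_sym : X^T = X.
  by case: XX0 => Q _ <-; rewrite !trmx_mul trmxK X0_sym mulmxA.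
(* The orthogonal factor of [L] has determinant 1, so [diag_mx lam] lies in the same class as
   [X]. *)
have [lam [L [lL XE]]] := symmetric_chart X_sym; exists lam.
  have := XX0; rewrite -XE; apply: orth_class_trans.
  by apply: orth_factor_SO; exact: lL.1.
by split=> //; rewrite -XE; have [] := chart_invK lL.
Qed.
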